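(* Let $\mathcal{L}$ be a finite relational language, $T$ a complete $\mathcal L$-theory with monster model $\mathcal U$ and small $M\prec\mathcal U$. Suppose $\mu\in\mathfrak{M}_x^{\mathrm{inv}}(\mathcal{U},M)$ satisfies the excellent measure extension axiom and does not concentrate on points, and let $N$ be an $\mathcal L$-structure with $\mathbb{P}_\mu(B_N)=1$. Then $\mathrm{Th}_{\mathcal L}(N)$ is countably categorical.
   Context: Keisler measures: for a (possibly infinite) tuple of variables $x$ and $A\subseteq\mathcal U$, $S_x(A)$ is the Stone space of complete types over $A$; a Keisler measure is a finitely additive probability measure on $\mathcal L(A)$-formulas in $x$, identified with its regular Borel extension to $S_x(A)$; $[\varphi]$ is the clopen set of types containing $\varphi$. $\mu\in\mathfrak M_x(\mathcal U)$ is $M$-invariant if $\mu(\varphi(x,a))=\mu(\varphi(x,b))$ for all $\mathcal L$-formulas $\varphi(x,y)$ and $a\equiv_M b$; these form $\mathfrak M^{\mathrm{inv}}_x(\mathcal U,M)$. For small $N'\supseteq M$ and an $\mathcal L(N')$-formula $\varphi(x,y)$, $F^\varphi_{\mu,N'}:S_y(N')\to[0,1]$, $q\mapsto\mu(\varphi(x,b))$, $b\models q$. Borel-definable over $M$: all $F^\varphi_{\mu,M}$ Borel. Morley product (for $\mu$ Borel-definable): $(\mu\otimes\nu)(\varphi(x,y))=\int_{S_y(N')}F^\varphi_{\mu,N'}\,d(\nu|_{N'})$, $N'\supseteq M$ small containing the parameters. $\mu^{(1)}=\mu(x_1)$, $\mu^{(n+1)}=\mu(x_{n+1})\otimes\mu^{(n)}(x_1,\dots,x_n)$.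 $M$-adequate: $\mu$ and all $\mu^{(n)}$ Borel-definable over $M$ and iterated Morley products of $\mu$ independent of parenthesization; $M$-excellent: additionally $\mu_x\otimes\mu_y=\mu_y\otimes\mu_x$. $\mathbb P_\mu$ is the regular Borel probability measure on $S_{\mathbf x}(\mathcal U)$, $\mathbf x=(x_i)_{i\ge1}$, with $\mathbb P_\mu([\varphi(x_1,\dots,x_n)])=\mu^{(n)}(\varphi(x_1,\dots,x_n))$. $\mu$ does not concentrate on points if $\mu(x=a)=0$ for all $a\in\mathcal U$. For $p\in S_{\mathbf x}(\mathcal U)$, $p_{\mathcal L}$ is the isomorphism type of the substructure induced on $\{a_i:i\ge1\}$ for any realization $(a_i)$ of $p$ in an elementary extension of $\mathcal U$; $B_N=\{p: p_{\mathcal L}\cong N\}$. $\mathrm{diag}_{\bar a}(x_1,\dots,x_n)$ is the conjunction of the atomic and negated atomic $\mathcal L$-formulas true of $\bar a=(a_1,\dots,a_n)$. Excellent measure extension axiom: $\mu$ is $M$-excellent and for all $a_1,\dots,a_{n+1}\in\mathcal U$, $\bar a=(a_1,\dots,a_n)$, if $(\mu_{x_{n+1}}\otimes\mu^{(n)})(\mathrm{diag}_{\bar a,a_{n+1}}(x_1,\dots,x_{n+1}))>0$ then $\mu^{(n)}|_M\big([\mathrm{diag}_{\bar a}(x_1,\dots,x_n)]\cap\{q\in S_{x_1..x_n}(M): \mu(\neg\mathrm{diag}_{\bar a,a_{n+1}}(\bar c,x_{n+1}))=1 \text{ for }\bar c\models q\}\big)=0$. *)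

(* Defs.v *)
From HB Require Import structures.
From mathcomp Require Import all_boot all_order all_algebra.
From mathcomp Require Import all_classical all_reals all_analysis.
Set Implicit Arguments. Unset Strict Implicit. Unset Printing Implicit Defensive.
Import Order.TTheory GRing.Theory Num.Theory.
Local Open Scope classical_set_scope.
Local Open Scope ring_scope.

(** * First-order logic over a finite relational language *)

Record language := Language { symbol :> finType; arity : symbol -> nat }.

Record structure (L : language) := Structure {
  dom :> Type;
  interp : forall r : L, (arity r).-tuple dom -> Prop;
  dom_inhabited : inhabited dom }.

(** [formula L V]: formulas with free variables in [V]; [FAll] binds the variable
    [None] of its body. *)
Inductive formula (L : language) (V : Type) : Type :=
| FBot
| FEq (x y : V)
| FRel (r : L) (t : (arity r).-tuple V)
| FImp (f g : formula L V)
| FAll (f : formula L (option V)).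
Arguments FBot {L V}.
Arguments FEq {L V}.

Section connectives.
Context {L : language} {V : Type}.
Implicit Types f g : formula L V.
Definition FNeg f := FImp f FBot.
Definition FTop : formula L V := FNeg FBot.
Definition FAnd f g := FNeg (FImp f (FNeg g)).
Definition FOr f g := FImp (FNeg f) g.
End connectives.

Fixpoint rename {L : language} {V W : Type} (s : V -> W) (f : formula L V) : formula L W :=
  match f with
  | FBot => FBot
  | FEq x y => FEq (s x) (s y)
  | FRel r t => FRel (map_tuple s t)
  | FImp f g => FImp (rename s f) (rename s g)
  | FAll f => FAll (rename (omap s) f)
  end.

Fixpoint occurs {L : language} {V : Type} (f : formula L V) : V -> Prop :=
  match f with
  | FBot => fun=> False
  | FEq y z => fun x => x = y \/ x = z
  | FRel r t => fun x => exists i, x = tnth t i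
  | FImp f g => fun x => occurs f x \/ occurs g x
  | FAll f => fun x => occurs f (Some x)
  end.

Fixpoint sat {L : language} (S : structure L) {V : Type} (v : V -> S)
    (f : formula L V) : Prop :=
  match f with
  | FBot => False
  | FEq x y => v x = v y
  | FRel r t => interp (map_tuple v t)
  | FImp f g => sat v f -> sat v g
  | FAll f => forall a : S, sat (fun o => if o is Some x then v x else a) f
  end.

Definition models {L : language} (S : structure L) (T : set (formula L void)) : Prop :=
  forall f, T f -> sat (of_void S) f.

Definition theory {L : language} (S : structure L) : set (formula L void) :=
  [set f | sat (of_void S) f].

Definition entails {L : language} (T : set (formula L void)) (f : formula L void) : Prop :=
  forall S : structure L, models S T -> sat (of_void S) f.

Definition complete_theory {L : language} (T : set (formula L void)) : Prop :=
  (exists S : structure L, models S T) /\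
  forall f, entails T f \/ entails T (FNeg f).

Definition is_isomorphism {L : language} (S S' : structure L) (h : S -> S') : Prop :=
  bijective h /\ forall (r : L) (t : (arity r).-tuple S), interp t <-> interp (map_tuple h t).

Definition isomorphic {L : language} (S S' : structure L) : Prop :=
  exists h : S -> S', is_isomorphism h.

Definition elementary_embedding {L : language} (S S' : structure L) (j : S -> S') : Prop :=
  forall n (f : formula L 'I_n) (v : 'I_n -> S), sat v f <-> sat (j \o v) f.

Definition set_inhabited {T : Type} (A : set T) (hA : A !=set0) : inhabited A :=
  let: ex_intro x Ax := hA in inhabits (exist _ x (mem_set Ax)).

Definition substructure {L : language} (S : structure L) (A : set S) (hA : A !=set0) :
    structure L :=
  Structure (fun r (t : (arity r).-tuple A) => interp (map_tuple val t)) (set_inhabited hA).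

Definition elementary_substructure {L : language} (S : structure L) (A : set S) : Prop :=
  exists hA : A !=set0, elementary_embedding (val : substructure hA -> S).

Definition countably_infinite {L : language} (S : structure L) : Prop :=
  ([set: S] #= [set: nat])%card.

(** Exactly one countably infinite model up to isomorphism. *)
Definition countably_categorical {L : language} (T : set (formula L void)) : Prop :=
  (exists S : structure L, models S T /\ countably_infinite S) /\
  forall S S' : structure L, models S T -> models S' T ->
    countably_infinite S -> countably_infinite S' -> isomorphic S S'.

(** * Types

    An L(U)-formula in variables indexed by [I] is an element of
    [formula L (I + U)]: parameters are free variables of the form [inr u]. *)

HB.instance Definition _ (L : language) (V : Type) := gen_eqMixin (formula L V).
HB.instance Definition _ (L : language) (V : Type) := gen_choiceMixin (formula L V).
HB.instance Definition _ (L : language) (V : Type) := isPointed.Build (formula L V) FBot.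

Definition assign {I U W : Type} (a : I -> W) (j : U -> W) (x : I + U) : W :=
  match x with inl i => a i | inr u => j u end.

Definition params {L : language} {I U : Type} (f : formula L (I + U)) : set U :=
  [set u | occurs f (inr u)].

Definition params_in {L : language} {I U : Type} (A : set U) (f : formula L (I + U)) : Prop :=
  params f `<=` A.

Definition no_params {L : language} {I U : Type} (f : formula L I) : formula L (I + U) :=
  rename inl f.

Definition rename_vars {L : language} {I J U : Type} (s : I -> J) :
    formula L (I + U) -> formula L (J + U) :=
  rename (assign (inl \o s) inr).

(** [f(x, y)] with [y := b]. *)
Definition plug {L : language} {I J U : Type} (b : J -> U) :
    formula L ((I + J) + U) -> formula L (I + U) :=
  rename (assign (assign inl (inr \o b)) inr).

Section types.
Context {L : language} {U : structure L}.
Implicit Types A : set U.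

Record is_complete_type (I : Type) A (p : set (formula L (I + U))) : Prop := {
  type_over : p `<=` params_in A;
  type_finsat : forall s : seq (formula L (I + U)), (forall f, f \in s -> p f) ->
    exists b : I -> U, forall f, f \in s -> sat (assign b id) f;
  type_total : forall f, params_in A f -> p f \/ p (FNeg f) }.

Record stone (I : Type) A := Stone {
  formulas :> formula L (I + U) -> Prop;
  formulasP : is_complete_type A formulas }.

Definition cylinder {I : Type} A (f : formula L (I + U)) : set (stone I A) :=
  [set p | formulas p f].

Definition realizes {I : Type} A (b : I -> U) (p : stone I A) : Prop :=
  forall f, p f -> sat (assign b id) f.

Definition equiv_over {I : Type} A (a b : I -> U) : Prop :=
  forall f : formula L (I + U), params_in A f ->
    (sat (assign a id) f <-> sat (assign b id) f).

Lemma type_of_subproof (I : Type) A (b : I -> U) :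
  is_complete_type A [set f | params_in A f /\ sat (assign b id) f].
Proof.
split=> [f [] // | s sP | f oAf]; first by exists b => f /sP[].
have [bf|nbf] := pselect (sat (assign b id) f); [by left|right; split=> //].
by move=> u [/oAf|].
Qed.

Definition type_of (I : Type) A (b : I -> U) : stone I A := Stone (type_of_subproof A b).

Lemma params_in_And (I : Type) A (f g : formula L (I + U)) :
  params_in A f -> params_in A g -> params_in A (FAnd f g).
Proof. by move=> oAf oAg u /= [[/oAf|[/oAg|]]|]. Qed.

Lemma formulas_And (I : Type) A (p : stone I A) (f g : formula L (I + U)) :
  p f -> p g -> p (FAnd f g).
Proof.
move=> pf pg; have [oAp finp totp] := formulasP p.
have [//|npfg] := totp _ (params_in_And (oAp _ pf) (oAp _ pg)).
have [|b bP] := finp [:: f; g; FNeg (FAnd f g)].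
  by move=> h; rewrite !inE => /orP[/eqP->|/orP[/eqP->|/eqP->]].
have := bP f; have := bP g; have := bP (FNeg (FAnd f g)).
rewrite !inE !eqxx !orbT /= => /(_ isT) nfg /(_ isT) bg /(_ isT) bf.
by case: nfg => /(_ bf); apply.
Qed.

Lemma formulas_sub_And (I : Type) A (p : stone I A) (f g : formula L (I + U)) :
  params_in A f -> params_in A g -> p (FAnd f g) -> p f /\ p g.
Proof.
move=> oAf oAg pfg; have [oAp finp totp] := formulasP p.
split.
  have [//|pn] := totp _ oAf.
  have [|b bP] := finp [:: FAnd f g; FNeg f].
    by move=> h; rewrite !inE => /orP[/eqP->|/eqP->].
  have := bP (FAnd f g); have := bP (FNeg f).
  rewrite !inE !eqxx !orbT /= => /(_ isT) bn /(_ isT) bfg.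
  by case: bfg => /bn.
have [//|pn] := totp _ oAg.
have [|b bP] := finp [:: FAnd f g; FNeg g].
  by move=> h; rewrite !inE => /orP[/eqP->|/eqP->].
have := bP (FAnd f g); have := bP (FNeg g).
rewrite !inE !eqxx !orbT /= => /(_ isT) bn /(_ isT) bfg.
by case: bfg => _ /bn.
Qed.

Lemma formulas_Top (I : Type) A (p : stone I A) : p FTop.
Proof.
have [oAp finp totp] := formulasP p.
have [|//|pn] := totp FTop; first by move=> u /= [].
have [|b /(_ (FNeg FTop))] := finp [:: FNeg FTop].
  by move=> h; rewrite inE => /eqP->.
by rewrite inE eqxx => /(_ isT) /=; case.
Qed.

End types.
Arguments stone {L} U I A.
Arguments cylinder {L U I} A f.

(** The Stone topology, with base the sets [cylinder A f]. *)

HB.instance Definition _ (L : language) (U : structure L) (I : Type) (A : set U) :=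
  gen_eqMixin (stone U I A).
HB.instance Definition _ (L : language) (U : structure L) (I : Type) (A : set U) :=
  gen_choiceMixin (stone U I A).

Section stone_topology.
Context {L : language} (U : structure L) (I : Type) (A : set U).

Let base_cover : \bigcup_(f in params_in A) cylinder (I := I) A f = setT.
Proof.
apply/seteqP; split=> // p _; exists FTop; last exact: formulas_Top.
by move=> u /= [].
Qed.

Let base_join (f g : formula L (I + U)) (p : stone U I A) :
  params_in A f -> params_in A g -> cylinder A f p -> cylinder A g p ->
  exists h, [/\ params_in A h, cylinder A h p & cylinder A h `<=` cylinder A f `&` cylinder A g].
Proof.
move=> oAf oAg pf pg; exists (FAnd f g); split; [exact: params_in_And|exact: formulas_And|].
by move=> q /(formulas_sub_And oAf oAg).
Qed.

Let stone_point : stone U I A.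
Proof.
have [u] := cid (let: inhabits u := dom_inhabited U in ex_intro (fun=> True) u Logic.I).
by move=> _; exact: (type_of A (fun=> u)).
Qed.

HB.instance Definition _ := isBaseTopological.Build (stone U I A) base_cover base_join.
HB.instance Definition _ := isPointed.Build (stone U I A) stone_point.
End stone_topology.

Definition borel_stone {L : language} (U : structure L) (I : Type) (A : set U) :=
  g_sigma_algebraType (@open (stone U I A)).
Arguments borel_stone {L} U I A.

(** * Monster models

    A cardinal is represented by a type [K] of that cardinality.  As the
    language is finite, [K] only has to be uncountable in order to exceed the
    cardinality of the theory. *)

Definition small_set {L : language} (K : Type) (U : structure L) (A : set U) : Prop :=
  (A #<= [set: K])%card && ~~ ([set: K] #<= A)%card.

Record monster {L : language} (K : Type) (U : structure L) : Prop := {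
  monster_uncountable : ~ countable [set: K];
  monster_saturated : forall (A : set U) n (p : stone U 'I_n A), small_set K A ->
    exists b, realizes b p;
  monster_homogeneous : forall (A : set U) (e : U -> U), small_set K A ->
    (forall n (f : formula L 'I_n) (v : 'I_n -> U), (forall i, A (v i)) ->
       sat v f <-> sat (e \o v) f) ->
    exists s : U -> U, is_isomorphism s /\ forall a, A a -> s a = e a }.

(** * Keisler measures *)

Section keisler.
Context {R : realType} {L : language} {U : structure L}.
Implicit Types (M A : set U).

Record is_keisler {I : Type} (mu : formula L (I + U) -> R) : Prop := {
  keisler_ge0 : forall f, 0 <= mu f;
  keisler_top : mu FTop = 1;
  keisler_equiv : forall f g,
    (forall b : I -> U, sat (assign b id) f <-> sat (assign b id) g) -> mu f = mu g;
  keisler_additive : forall f g,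
    (forall b : I -> U, ~ sat (assign b id) (FAnd f g)) -> mu (FOr f g) = mu f + mu g }.

Definition invariant_over {I : Type} M (mu : formula L (I + U) -> R) : Prop :=
  forall n (f : formula L (I + 'I_n)) (a b : 'I_n -> U),
    equiv_over M a b -> mu (plug a (no_params f)) = mu (plug b (no_params f)).

Definition regular_measure {I : Type} A
    (lambda : {measure set (borel_stone U I A) -> \bar R}) : Prop :=
  forall B : set (borel_stone U I A), measurable B ->
    lambda B = ereal_sup [set lambda C | C in
      [set C : set (stone U I A) | closed C /\ C `<=` B]] /\
    lambda B = ereal_inf [set lambda O | O in
      [set O : set (stone U I A) | open O /\ B `<=` O]].

Definition is_borel_extension {I : Type} A (nu : formula L (I + U) -> R)
    (lambda : {measure set (borel_stone U I A) -> \bar R}) : Prop :=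
  regular_measure lambda /\
  forall f, params_in A f -> lambda (cylinder A f) = (nu f)%:E.

(** The regular Borel measure on S_I(A) identified with the restriction of
    [nu] to [A]; it exists and is unique when [nu] is a Keisler measure. *)
Definition borel_extension {I : Type} A (nu : formula L (I + U) -> R) :
    {measure set (borel_stone U I A) -> \bar R} :=
  if pselect (exists lambda, is_borel_extension (A := A) nu lambda) is left h
  then sval (cid h) else mzero.

(** q |-> mu(f(x, b)) for b realizing q. *)
Definition fiber {I J : Type} A (mu : formula L (I + U) -> R)
    (f : formula L ((I + J) + U)) (q : borel_stone U J A) : R :=
  xget 0 [set mu (plug b f) | b in [set b | realizes b q]].

Definition borel_definable {I : Type} M (mu : formula L (I + U) -> R) : Prop :=
  invariant_over M mu /\
  forall n (f : formula L ((I + 'I_n) + U)), params_in M f ->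
    measurable_fun setT (fiber (A := M) mu f).

(** [N'] is the least admissible set of parameters; when [mu] is Borel-definable
    over [M], any other small one gives the same value. *)
Definition morley {I J : Type} M (mu : formula L (I + U) -> R) (nu : formula L (J + U) -> R) :
    formula L ((I + J) + U) -> R :=
  fun f => let N' := M `|` params f in
    \int[borel_extension N' nu]_q fiber mu f q.

Definition last_first {n : nat} (i : 'I_n.+1) : 'I_1 + 'I_n :=
  if unlift ord_max i is Some j then inr j else inl ord0.

(** [power M mu n] is the power with exponent [n.+1], on the variables
    x_0, ..., x_n; the last variable belongs to the left factor. *)
Fixpoint power M (mu : formula L ('I_1 + U) -> R) (n : nat) : formula L ('I_n.+1 + U) -> R :=
  match n return formula L ('I_n.+1 + U) -> R with
  | 0 => mu
  | m.+1 => fun f => morley M mu (@power M mu m) (rename_vars last_first f)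
  end.
Arguments power M mu n f : clear implicits.

Inductive parenthesization := Leaf | Node (s t : parenthesization).

Fixpoint leaves (t : parenthesization) : nat :=
  if t is Node s t then (leaves t + leaves s)%N else 1%N.

Definition swap_sum {X Y : Type} (z : X + Y) : Y + X :=
  match z with inl x => inr x | inr y => inl y end.

(** As in [power], the left factor gets the later variables. *)
Fixpoint iterated M (mu : formula L ('I_1 + U) -> R) (t : parenthesization) :
    formula L ('I_(leaves t) + U) -> R :=
  match t return formula L ('I_(leaves t) + U) -> R with
  | Leaf => mu
  | Node s t => fun f =>
      morley M (@iterated M mu s) (@iterated M mu t)
        (rename_vars (fun i => swap_sum (fintype.split i)) f)
  end.
Arguments iterated M mu t f : clear implicits.

Definition adequate M (mu : formula L ('I_1 + U) -> R) : Prop :=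
  (forall n, borel_definable M (power M mu n)) /\
  forall n t (e : leaves t = n.+1) f,
    iterated M mu t f = power M mu n (rename_vars (cast_ord e) f).

Definition excellent M (mu : formula L ('I_1 + U) -> R) : Prop :=
  adequate M mu /\
  forall f : formula L (('I_1 + 'I_1) + U),
    morley M mu mu f = morley M mu mu (rename_vars swap_sum f).

Definition no_point_mass (mu : formula L ('I_1 + U) -> R) : Prop :=
  forall a : U, mu (FEq (inl ord0) (inr a)) = 0.

(** The property characterizing P_mu; the variable x_i is indexed by [i.-1]. *)
Definition is_path_measure M (mu : formula L ('I_1 + U) -> R)
    (P : probability (borel_stone U nat setT) R) : Prop :=
  regular_measure P /\
  forall n (f : formula L ('I_n.+1 + U)),
    P (cylinder setT (rename_vars (@nat_of_ord n.+1) f)) = (power M mu n f)%:E.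

(** * The extension axiom *)

Definition atoms n : seq (formula L 'I_n) :=
  [seq FEq i j | i <- enum 'I_n, j <- enum 'I_n] ++
  flatten [seq [seq FRel t | t <- enum {: (arity r).-tuple 'I_n}] | r <- enum L].

Definition diag n (a : 'I_n -> U) : formula L 'I_n :=
  foldr FAnd FTop [seq if `[< sat a f >] then f else FNeg f | f <- atoms n].

Definition excellent_extension M (mu : formula L ('I_1 + U) -> R) : Prop :=
  excellent M mu /\
  forall n (a : 'I_n.+2 -> U),
    let a' : 'I_n.+1 -> U := a \o lift ord_max in
    0 < power M mu n.+1 (no_params (diag a)) ->
    borel_extension M (power M mu n)
      (cylinder M (no_params (diag a')) `&`
       [set q | fiber mu (no_params (rename last_first (FNeg (diag a)))) q = 1]) = 0%E.

End keisler.
Arguments power {R L U} M mu n f.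
Arguments iterated {R L U} M mu t f.

(** The types [p] such that the structure induced on a realization of [p] in an
    elementary extension of [U] is isomorphic to [N]; this does not depend on the
    extension or on the realization. *)
Definition iso_class {L : language} (U N : structure L) : set (stone U nat setT) :=
  [set p | exists (W : structure L) (j : U -> W) (a : nat -> W),
     [/\ elementary_embedding j, (forall f, p f -> sat (assign a j) f) &
         exists ha : range a !=set0, isomorphic (substructure ha) N]].

(* Main.v *)
(** Sampling x_0, x_1, ... from the Morley powers of mu is exchangeable:
    excellence makes each power invariant under transposing its last two
    variables, and these transpositions together with the permutations fixing the
    last variable generate the symmetric group.  Let d be a diagram of n+2 points
    of positive measure and F(q) the conditional probability that a fresh point
    fails to extend the tuple q to d.  The probability that n+1 given points
    realize the restriction d' of d and that the next k+1 candidates all fail is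
    the integral of F over the event that the first k failed.  Hence 1 - F
    integrates to 0 over the event that all candidates fail, and the extension
    axiom says that F = 1 has measure 0 inside d'.  So almost surely every
    realization of d' extends to d, while diagrams of measure 0 are almost surely
    not realized.  As the language is finite there are countably many such
    conditions; a path satisfying all of them induces a structure with the
    one-point extension property for diagrams.  That property is a set of
    first-order sentences, and back-and-forth applies to any two countably
    infinite models of them. *)

Require Import Defs.
From HB Require Import structures.
From mathcomp Require Import all_boot all_order all_algebra.
From mathcomp Require Import all_classical all_reals all_analysis.
From mathcomp Require Import perm zify lra measurable_realfun.
Set Implicit Arguments. Unset Strict Implicit. Unset Printing Implicit Defensive.
Import Order.TTheory GRing.Theory Num.Theory.
Local Open Scope classical_set_scope.
Local Open Scope ring_scope.

(** * Renaming of variables *)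

Section formulas.
Context {L : language}.

Lemma map_tuple_comp {X Y Z : Type} n (g : Y -> Z) (f : X -> Y) (t : n.-tuple X) :
  map_tuple g (map_tuple f t) = map_tuple (g \o f) t.
Proof. by apply: val_inj; rewrite /= -map_comp. Qed.

Lemma rename_comp {V W X : Type} (s : W -> X) (t : V -> W) (f : formula L V) :
  rename s (rename t f) = rename (s \o t) f.
Proof.
elim: f W X s t => {V} [V|V x y|V r t'|V f IHf g IHg|V f IH] W X s t //=.
- by rewrite map_tuple_comp.
- by rewrite IHf IHg.
- by rewrite IH; congr (FAll (rename _ _)); apply/funext; case.
Qed.

(** Agreement is asked only on occurring variables because in [plug_invariant] a parameter has a
    meaningful index only if it occurs in the formula. *)
Lemma eq_rename {V W : Type} (s t : V -> W) (f : formula L V) :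
  (forall x, occurs f x -> s x = t x) -> rename s f = rename t f.
Proof.
elim: f W s t => {V} [V|V x y|V r t'|V f IHf g IHg|V f IH] W s t //= st.
- by rewrite !st; [|right|left].
- congr FRel; apply: eq_from_tnth => i; rewrite !tnth_map.
  by apply: st; exists i.
- by congr FImp; [apply: IHf|apply: IHg] => x fx; apply: st; [left|right].
- by congr FAll; apply: IH => -[x|] //= /st ->.
Qed.

Lemma rename_id {V : Type} (f : formula L V) : rename id f = f.
Proof.
elim: f => {V} [V|V x y|V r t|V f IHf g IHg|V f IH] //=.
- by congr FRel; apply: eq_from_tnth => i; rewrite tnth_map.
- by rewrite IHf IHg.
- by rewrite -[in RHS]IH; congr (FAll (rename _ _)); apply/funext; case.
Qed.

Lemma occurs_rename {V W : Type} (s : V -> W) (f : formula L V) y :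
  occurs (rename s f) y -> exists2 x, occurs f x & y = s x.
Proof.
elim: f W s y => {V} [V|V x1 x2|V r t|V f IHf g IHg|V f IH] W s y //=.
- by case=> ->; [exists x1; first left|exists x2; first right].
- by case=> i ->; rewrite tnth_map; exists (tnth t i) => //; exists i.
- case=> [fy|gy]; [have [x ? ->] := IHf _ _ _ fy|have [x ? ->] := IHg _ _ _ gy];
    exists x => //; by [left|right].
- by move=> fy; have [[x|] //= fx [->]] := IH _ _ _ fy; exists x.
Qed.

Lemma occurs_rename_inv {V W : Type} (s : V -> W) (f : formula L V) x :
  occurs f x -> occurs (rename s f) (s x).
Proof.
elim: f W s x => {V} [V|V x1 x2|V r t|V f IHf g IHg|V f IH] W s x //=.
- by case=> ->; [left|right].
- by case=> i ->; exists i; rewrite tnth_map.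
- by case=> [fx|gx]; [left; apply: IHf|right; apply: IHg].
- by move=> fx; apply: (IH _ (omap s) _ fx).
Qed.

Lemma sat_rename (S : structure L) {V W : Type} (s : V -> W) (v : W -> S)
    (f : formula L V) : sat v (rename s f) = sat (v \o s) f.
Proof.
elim: f W s v => {V} [V|V x1 x2|V r t|V f IHf g IHg|V f IH] W s v //=.
- by rewrite map_tuple_comp.
- by rewrite IHf IHg.
- apply: eq_forall => a; rewrite IH; congr (sat _ _).
  by apply/funext; case.
Qed.

Lemma sat_And (S : structure L) {V : Type} (v : V -> S) (f g : formula L V) :
  sat v (FAnd f g) <-> sat v f /\ sat v g.
Proof.
split=> [/= h|[vf vg] nfg]; last exact: nfg vf vg.
by split; apply: contrapT => n; apply: h => vf // vg; exact: n.
Qed.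

Lemma sat_Or (S : structure L) {V : Type} (v : V -> S) (f g : formula L V) :
  sat v (FOr f g) <-> sat v f \/ sat v g.
Proof.
split=> [/= h|[vf|vg] nf //]; last by case: nf.
by have [vf|nf] := pselect (sat v f); [left|right; apply: h].
Qed.

Lemma finitely_many_occur {V : Type} (f : formula L V) :
  exists n (c : 'I_n -> V), forall x, occurs f x -> exists i, x = c i.
Proof.
elim: f => {V} [V|V x1 x2|V r t|V f [n [c fc]] g [m [d gd]]|V f [n [c fc]]].
- exists 0%N; exists (fun i : 'I_0 => False_rect _ (notF (ltn_ord i))) => //.
- exists 2%N; exists (fun i => if i == ord0 then x1 else x2) => x [] ->.
    by exists ord0.
  by exists ord_max.
- by exists (arity r), (tnth t) => x [i ->]; exists i.
- exists (n + m)%N, (fun i => match fintype.split i with inl i => c i | inr i => d i end).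
  move=> x [/fc[i ->]|/gd[i ->]].
    by exists (lshift m i); rewrite (unsplitK (inl i)).
  by exists (rshift n i); rewrite (unsplitK (inr i)).
(* The enumeration for the body may list the bound variable [None]. Such slots are filled with an
   occurring variable [x0]; if there is none, the empty enumeration serves. *)
- have [noc|/existsNP[x0 /contrapT x0P]] := pselect (forall x, ~ occurs (FAll f) x).
    by exists 0%N; exists (fun i : 'I_0 => False_rect _ (notF (ltn_ord i))) => x /noc.
  exists n, (fun i => if c i is Some x then x else x0) => x /fc[i ci].
  by exists i; rewrite -ci.
Qed.

End formulas.

(** * Stone spaces *)

Section stone_spaces.
Context {L : language} {U : structure L}.
Implicit Types A B : set U.

Lemma params_rename_vars {I J : Type} (s : I -> J) A (f : formula L (I + U)) :
  params_in A f -> params_in A (rename_vars s f).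
Proof.
move=> oAf u /= fu; have [[//|v] /= fv [uv]] := occurs_rename fu.
by rewrite uv; exact: oAf.
Qed.

Lemma params_no_params {I : Type} A (f : formula L I) : params_in A (no_params (U := U) f).
Proof. by move=> u /= fu; have [] := occurs_rename fu. Qed.

Lemma no_params_rename {I J : Type} (s : I -> J) (f : formula L I) :
  no_params (U := U) (rename s f) = rename_vars s (no_params f).
Proof. by rewrite /no_params /rename_vars !rename_comp. Qed.

Lemma rename_vars_comp {I J J' : Type} (s : J -> J') (t : I -> J) (f : formula L (I + U)) :
  rename_vars s (rename_vars t f) = rename_vars (s \o t) f.
Proof. by rewrite /rename_vars rename_comp; congr rename; apply/funext; case. Qed.

Lemma rename_vars_id {I : Type} (f : formula L (I + U)) : rename_vars id f = f.
Proof. by rewrite -[RHS]rename_id; congr rename; apply/funext; case. Qed.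

Lemma sat_rename_vars {I J : Type} (W : structure L) (s : I -> J) (b : J -> W) (j : U -> W)
    (f : formula L (I + U)) :
  sat (assign b j) (rename_vars s f) = sat (assign (b \o s) j) f.
Proof. by rewrite sat_rename; congr sat; apply/funext; case. Qed.

Lemma sat_no_params {I : Type} (W : structure L) (b : I -> W) (j : U -> W) (f : formula L I) :
  sat (assign b j) (no_params f) = sat b f.
Proof. exact: sat_rename. Qed.

Section one_type.
Context {I : Type} {A : set U} (p : stone U I A).

Lemma stone_entails1 f g : p f -> params_in A g ->
  (forall b : I -> U, sat (assign b id) f -> sat (assign b id) g) -> p g.
Proof.
move=> pf oAg fg; have [_ fin tot] := formulasP p.
have [//|png] := tot g oAg.
have [|b bP] := fin [:: f; FNeg g].
  by move=> h; rewrite !inE => /orP[/eqP->|/eqP->].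
have := bP f; have := bP (FNeg g); rewrite !inE !eqxx orbT => /(_ isT) /= ng /(_ isT) bf.
by exfalso; apply: ng; exact: fg.
Qed.

Lemma stoneN f : params_in A f -> p (FNeg f) <-> ~ p f.
Proof.
move=> oAf; have [_ fin tot] := formulasP p; split; last first.
  by have [|] := tot f oAf.
move=> pnf pf; have [|b bP] := fin [:: f; FNeg f].
  by move=> h; rewrite !inE => /orP[/eqP->|/eqP->].
by have := bP f; have := bP (FNeg f); rewrite !inE !eqxx orbT => /(_ isT) /= ng /(_ isT).
Qed.

Lemma stone_And f g : params_in A f -> params_in A g -> p (FAnd f g) <-> p f /\ p g.
Proof.
move=> oAf oAg; split; first exact: formulas_sub_And.
by case; exact: formulas_And.
Qed.

Lemma stone_Or f g : params_in A f -> params_in A g -> p (FOr f g) <-> p f \/ p g.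
Proof.
move=> oAf oAg; have oAfg : params_in A (FOr f g).
  by move=> u /= [[/oAf//|//]|/oAg].
split=> [pfg|].
  have [|/(stoneN oAf) pnf] := pselect (p f); first by left.
  right; apply: (stone_entails1 (formulas_And pfg pnf)) => // b /sat_And[].
  by move=> /sat_Or[//|//] bf /(_ bf).
by case=> h; apply: (stone_entails1 h) => // b bh; apply/sat_Or; [left|right].
Qed.

Lemma stone_realized f b : realizes b p -> params_in A f -> p f <-> sat (assign b id) f.
Proof.
move=> bp oAf; split; first exact: bp.
by move=> bf; apply: contrapT => /(stoneN oAf) /bp nbf; exact: nbf bf.
Qed.

End one_type.

Lemma realizes_equiv_over {n} A (b c : 'I_n -> U) (p : stone U 'I_n A) :
  realizes b p -> realizes c p -> equiv_over A b c.
Proof. by move=> bp cp f oAf; rewrite -(stone_realized bp oAf) (stone_realized cp oAf). Qed.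

Lemma open_stoneP {I : Type} A (O : set (stone U I A)) :
  open O <-> exists2 D, D `<=` params_in A & \bigcup_(f in D) cylinder A f = O.
Proof. by []. Qed.

Lemma open_cylinder {I : Type} A (f : formula L (I + U)) :
  params_in A f -> open (cylinder (I := I) A f).
Proof.
move=> oAf; apply/open_stoneP; exists [set f]; first by move=> _ ->.
by rewrite bigcup_set1.
Qed.

Lemma measurable_open_stone {I : Type} A (O : set (stone U I A)) :
  open O -> measurable (O : set (borel_stone U I A)).
Proof. exact: sub_sigma_algebra. Qed.

Lemma measurable_cylinder {I : Type} A (f : formula L (I + U)) :
  params_in A f -> measurable (cylinder A f : set (borel_stone U I A)).
Proof. by move=> oAf; apply: measurable_open_stone; exact: open_cylinder. Qed.

(** An ultrafilter converges to the set of formulas whose cylinders belong to it. Finitely many of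
    these cylinders have a common point, a type, and its own finite satisfiability gives that of the
    limit. *)
Lemma compact_stone {I : Type} A : compact [set: stone U I A].
Proof.
rewrite compact_ultra => F FU _.
have Ffilter := @ultra_proper _ _ FU.
pose p := [set f | params_in A f /\ F (cylinder (I := I) A f)].
have pP : is_complete_type A p.
  split=> [f []//|s sP|f oAf].
    have /filter_ex[q qs] : F [set q : stone U I A | forall f, f \in s -> q f].
      elim: s sP => [|f s IH] sP; first by apply: filterE.
      have [_ Ff] := sP f (mem_head _ _).
      have Fs := IH (fun g gs => sP g (@mem_behead _ (f :: s) g gs)).
      apply: filterS (filterI Ff Fs) => q [/= qf qs] g.
      by rewrite inE => /orP[/eqP->|/qs].
    by have [_ fin _] := formulasP q; exact: fin.
  have [Ff|Fnf] := in_ultra_setVsetC (cylinder A f) FU; first by left.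
  right; split=> //; first by move=> u [/oAf|].
  by apply: filterS Fnf => q /= /(stoneN _ oAf).
exists (Stone pP); split=> // B; rewrite nbhsE => -[V].
case=> /open_stoneP[D oD <-] [f Df [_ Ff]].
by move=> sB; apply: filterS Ff => q qf; apply: sB; exists f.
Qed.

Section restriction.
Context {I J : Type} (s : I -> J) {A B : set U} (AB : A `<=` B).

Lemma restr_subproof (p : stone U J B) :
  is_complete_type A [set f : formula L (I + U) | params_in A f /\ p (rename_vars s f)].
Proof.
split=> [f []//|fs fsP|f oAf].
  have [_ /(_ [seq rename_vars s f | f <- fs]) fin _] := formulasP p.
  case: fin => [_ /mapP[f /fsP[_ pf] ->]//|b bP].
  exists (b \o s) => f ffs; rewrite -sat_rename_vars; apply: bP.
  by rewrite map_f.
have oBf : params_in B (rename_vars s f).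
  by apply: params_rename_vars; exact: subset_trans AB.
have [_ _ /(_ _ oBf)[pf|pnf]] := formulasP p; [by left|right; split=> //].
by move=> u /= [/oAf|].
Qed.

(** One map covers passing to a subtuple of the variables, permuting them, and forgetting the
    parameters outside [A]. *)
Definition restr (p : stone U J B) : stone U I A := Stone (restr_subproof p).

Lemma realizes_restr (p : stone U J B) b : realizes b p -> realizes (b \o s) (restr p).
Proof. by move=> bp f [_ /bp]; rewrite sat_rename_vars. Qed.

Lemma preimage_restr_cylinder f : params_in A f ->
  restr @^-1` (cylinder A f) = cylinder B (rename_vars s f).
Proof. by move=> oAf; apply/seteqP; split=> p //= []. Qed.

Lemma open_preimage_restr O : open O -> open (restr @^-1` O).
Proof.
move=> /open_stoneP[D oD <-]; rewrite preimage_bigcup.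
apply: bigcup_open => f Df; rewrite preimage_restr_cylinder; last exact: oD.
apply: open_cylinder; apply: params_rename_vars; apply: subset_trans AB; exact: oD.
Qed.

Lemma measurable_restr :
  measurable_fun setT (restr : borel_stone U J B -> borel_stone U I A).
Proof.
apply: measurability => // _ [V oV <-].
by rewrite setTI; apply: measurable_open_stone; exact: open_preimage_restr.
Qed.

End restriction.

End stone_spaces.

(** * Regular measures and restriction of types *)

Section regular.
Context {R : realType} {L : language} {U : structure L}.
Context {I J : Type} (s : I -> J) {A B : set U} (AB : A `<=` B).

Lemma params_in_foldr_Or (fs : seq (formula L (I + U))) :
  (forall f, f \in fs -> params_in A f) -> params_in A (foldr FOr FBot fs).
Proof.
elim: fs => [|f fs IH] oAfs; first by move=> u.
move=> u [[/= fu|//]|fsu]; first exact: (oAfs f (mem_head _ _)).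
by apply: IH fsu => g gfs; apply: oAfs; rewrite inE gfs orbT.
Qed.

Lemma cylinder_foldr_Or (fs : seq (formula L (I + U))) :
  (forall f, f \in fs -> params_in A f) ->
  cylinder (I := I) A (foldr FOr FBot fs) = \bigcup_(f in [set` fs]) cylinder A f.
Proof.
elim: fs => [|f fs IH] oAfs.
  apply/seteqP; split=> [p /= pB|p [f]//]; exfalso.
  by have : ~ p FBot by apply/(stoneN p) => //; exact: formulas_Top.
have oAf : params_in A f by exact: (oAfs f (mem_head _ _)).
have oAs g : g \in fs -> params_in A g by move=> gfs; apply: oAfs; rewrite inE gfs orbT.
apply/seteqP; split=> p /=.
  case/(stone_Or p oAf (params_in_foldr_Or oAs)) => [pf|].
    by exists f => //=; rewrite mem_head.
  rewrite -[p _]/(cylinder A _ p) IH// => -[g gfs pg].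
  by exists g => //=; rewrite inE (gfs : g \in fs) orbT.
case=> g /=; rewrite inE => /orP[/eqP->|gfs] pg; apply/(stone_Or p oAf (params_in_foldr_Or oAs)).
  by left.
by right; rewrite -[p _]/(cylinder A _ p) IH//; exists g.
Qed.

(** With uncountably many parameters the cylinders need not generate the Borel sets, so regularity
    and compactness replace a monotone class argument. *)
Lemma regular_pushforward (lam : {measure set (borel_stone U I A) -> \bar R})
    (lam' : {measure set (borel_stone U J B) -> \bar R}) :
  regular_measure lam -> regular_measure lam' -> lam' setT = 1%E ->
  (forall f, params_in A f -> lam' (cylinder B (rename_vars s f)) = lam (cylinder A f)) ->
  forall X : set (borel_stone U I A), measurable X -> lam' (restr s AB @^-1` X) = lam X.
Proof.
move=> reg reg' tot' eqc.
have mrestr (X : set (borel_stone U I A)) : measurable X ->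
    measurable (restr s AB @^-1` X : set (borel_stone U J B)).
  by move=> mX; rewrite -[X in measurable X]setTI; apply: measurable_restr.
have tot : lam setT = 1%E.
  have cT (I' : Type) (A' : set U) : cylinder (I := I') A' FTop = setT.
    by apply/seteqP; split=> // p _; exact: formulas_Top.
  rewrite -(cT I A) -eqc; last by move=> u [].
  by rewrite (_ : rename_vars s FTop = FTop)// cT.
(* By inner regularity of [lam'] it is enough to bound closed sets inside the preimage. Such a set
   is compact, hence covered by the preimages of finitely many cylinders, whose union is the
   cylinder of a disjunction. *)
have le_open V : open V -> (lam' (restr s AB @^-1` V) <= lam V)%E.
  move=> oV; have oV' := @open_preimage_restr _ _ _ _ s _ _ AB _ oV.
  have [-> _] := reg' _ (measurable_open_stone oV').
  apply: ge_ereal_sup => _ [C [cC CV] <-].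
  have mC : measurable (C : set (borel_stone U J B)).
    rewrite -[C]setCK; apply: measurableC; apply: measurable_open_stone.
    by rewrite openC.
  have /open_stoneP[D oD DV] := oV.
  have cptC : compact C by apply: (subclosed_compact cC (@compact_stone _ _ _ _)).
  have [D' D'D CD'] : exists2 D' : seq (formula L (I + U)), (forall f, f \in D' -> D f) &
      C `<=` \bigcup_(f in [set` D']) (restr s AB @^-1` cylinder A f).
    move: cptC; rewrite compact_cover => /(_ _ D (fun f => restr s AB @^-1` cylinder A f)).
    case=> [f Df||D' D'D CD'].
    - by apply: open_preimage_restr; apply: open_cylinder; exact: oD.
    - by move=> p /CV; rewrite /preimage/= -DV => -[f Df pf]; exists f.
    - by exists (finmap.enum_fset D') => // f /D'D; rewrite inE.
  have oD' f : f \in D' -> params_in A f by move=> /D'D; exact: oD.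
  have eD' : cylinder (I := I) A (foldr FOr FBot D') = \bigcup_(f in [set` D']) cylinder A f.
    exact: cylinder_foldr_Or.
  have oF : params_in A (foldr FOr FBot D') by exact: params_in_foldr_Or.
  apply: (@le_trans _ _ (lam' (cylinder B (rename_vars s (foldr FOr FBot D'))))).
    apply: le_measure; rewrite ?inE//.
      by apply: measurable_cylinder; apply: params_rename_vars; exact: subset_trans AB.
    by rewrite -(preimage_restr_cylinder s AB)// eD' preimage_bigcup.
  rewrite eqc//; apply: le_measure; rewrite ?inE.
  - exact: measurable_cylinder.
  - exact: measurable_open_stone.
  by rewrite eD' -DV => p [f /D'D Df fp]; exists f.
have le_meas (X : set (borel_stone U I A)) : measurable X -> (lam' (restr s AB @^-1` X) <= lam X)%E.
  move=> mX; have [_ ->] := reg _ mX.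
  apply: le_ereal_inf_tmp => _ [V [oV XV] <-]; apply: le_trans (le_open V oV).
  apply: le_measure; rewrite ?inE; [exact: mrestr| |exact: preimage_subset].
  by apply: mrestr; exact: measurable_open_stone.
(* Both measures have total mass 1, so the inequality for [X] and for its complement forces
   equality. *)
move=> X mX; have le1 := le_meas _ mX; have le2 := le_meas _ (measurableC mX).
have e : (lam X + lam (~` X) = 1)%E.
  by rewrite -measureU ?setUv//; [exact: measurableC|rewrite setICr].
have e' : (lam' (restr s AB @^-1` X) + lam' (restr s AB @^-1` (~` X)) = 1)%E.
  rewrite preimage_setC -measureU ?setUv//; [exact: mrestr|apply: measurableC; exact: mrestr|].
  by rewrite setICr.
move: le1 le2 e e'; have := measure_ge0 lam X; have := measure_ge0 lam (~` X).
have := measure_ge0 lam' (restr s AB @^-1` X).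
have := measure_ge0 lam' (restr s AB @^-1` (~` X)).
case: (lam X) (lam (~` X)) (lam' (restr s AB @^-1` X))
  (lam' (restr s AB @^-1` (~` X))) => [a||] [b||] [c||] [d||] //=.
rewrite -?EFinD !lee_fin => ? ? ? ? ? ? [?] [?]; congr (_%:E).
by apply/eqP; rewrite eq_le; apply/andP; split; lra.
Qed.

End regular.

(** * Fibers of a Keisler measure *)

Section keisler_facts.
Context {R : realType} {L : language} {U : structure L}.

Section pushforward_integral.
Context {I J : Type} (s : I -> J) {A B : set U} (AB : A `<=` B).

Lemma integral_restr (lam : {measure set (borel_stone U I A) -> \bar R})
    (lam' : {measure set (borel_stone U J B) -> \bar R}) :
  regular_measure lam -> regular_measure lam' -> lam' setT = 1%E ->
  (forall f, params_in A f -> lam' (cylinder B (rename_vars s f)) = lam (cylinder A f)) ->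
  forall F : borel_stone U I A -> R, measurable_fun setT F -> (forall q, 0 <= F q) ->
  (\int[lam]_q (F q)%:E = \int[lam']_q (F (restr s AB q))%:E)%E.
Proof.
move=> reg reg' tot' eqc F mF F0.
have mr := @measurable_restr _ _ _ _ s _ _ AB.
rewrite -[RHS](@ge0_integral_pushforward _ _ _ _ _ _ mr lam' setT (EFin \o F))//=.
- by apply: eq_measure_integral => X mX _; rewrite /= /pushforward (regular_pushforward AB reg reg').
- exact/measurable_EFinP.
- by move=> q _; rewrite lee_fin.
Qed.

End pushforward_integral.

Section keisler_arith.
Context {I : Type} (mu : formula L (I + U) -> R) (kmu : is_keisler mu).

Lemma keisler_bot : mu FBot = 0.
Proof.
have e : mu (FOr FTop FBot) = mu FTop.
  by apply: (keisler_equiv kmu) => b; rewrite sat_Or; split=> [[]//|]; by left.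
have := e; rewrite (keisler_additive kmu); last by move=> b /sat_And[].
by move/(canRL (addKr _)); rewrite addNr.
Qed.

Lemma keisler_neg f : mu (FNeg f) = 1 - mu f.
Proof.
have e : mu (FOr f (FNeg f)) = mu FTop.
  apply: (keisler_equiv kmu) => b; rewrite sat_Or; split=> [_|_]; first exact: id.
  by have [bf|bf] := pselect (sat (assign b id) f); [left|right].
apply: (addrI (mu f)); rewrite addrCA subrr addr0 -(keisler_top kmu) -e.
by rewrite (keisler_additive kmu)// => b /sat_And[bf]; apply.
Qed.

Lemma keisler_le1 f : mu f <= 1.
Proof. by have := keisler_ge0 kmu (FNeg f); rewrite keisler_neg subr_ge0. Qed.

End keisler_arith.

Lemma sat_plug {I J : Type} (b : J -> U) (a : I -> U) (f : formula L ((I + J) + U)) :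
  sat (assign a id) (plug b f) = sat (assign (assign a b) id) f.
Proof. by rewrite sat_rename; congr sat; apply/funext; case=> [[]|]. Qed.

Lemma plug_rename_vars {I J I' J' : Type} (b : J' -> U) (s : I -> I') (t : J -> J')
    (f : formula L ((I + J) + U)) :
  plug b (rename_vars (assign (inl \o s) (inr \o t)) f) = rename_vars s (plug (b \o t) f).
Proof.
by rewrite /plug /rename_vars !rename_comp; congr rename; apply/funext; case=> [[]|].
Qed.

Lemma params_in_rename {I J : Type} (k : I + U -> J + U) (M : set U) (f : formula L (I + U)) :
  params_in M f -> (forall x u, k x = inr u -> (exists i, x = inl i) -> M u) ->
  (forall v u, k (inr v) = inr u -> M v -> M u) -> params_in M (rename k f).
Proof.
move=> oMf k1 k2 u /= fu; have [x fx e] := occurs_rename fu; case: x fx e => [i|v] fx e.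
  by apply: (k1 (inl i)) => //; exists i.
by apply: (k2 v) => //; exact: oMf.
Qed.

Lemma fiber_unique {I J : Type} (M : set U) (mu : formula L (I + U) -> R)
    (f : formula L ((I + J) + U)) (q : borel_stone U J M) b :
  realizes b q -> (forall c, realizes c q -> mu (plug c f) = mu (plug b f)) ->
  fiber mu f q = mu (plug b f).
Proof.
move=> bq h; apply: xget_subset1; first by exists b.
by move=> _ _ [c /h -> <-] [d /h -> <-].
Qed.

Section invariant.
Context {I : Type} (M : set U) (M0 : M !=set0) (mu : formula L (I + U) -> R).
Hypothesis inv : invariant_over M mu.

(* [invariant_over] quantifies over parameter-free formulas, so the parameters
   from [M] are moved into the tuple. *)
Lemma plug_invariant n (f : formula L ((I + 'I_n) + U)) (a b : 'I_n -> U) :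
  params_in M f -> equiv_over M a b -> mu (plug a f) = mu (plug b f).
Proof.
move=> oMf ab; have [u0 Mu0] := M0.
have [m [c cP]] : exists m (c : 'I_m.+1 -> U),
    (forall i, M (c i)) /\ forall u, params f u -> exists i, u = c i.
  have [m [d dP]] := finitely_many_occur f.
  (* Slot 0 always holds [u0], which gives [idx] a default; slots without a parameter from [M] are
     filled with [u0] as well. *)
  exists m, (fun i => if unlift ord0 i is Some j then
    if d j is inr u then if pselect (M u) then u else u0 else u0 else u0).
  split=> [i|u fu].
    by case: unlift => [j|//]; case: (d j) => // u; case: pselect.
  have [j dj] := dP _ fu; exists (lift ord0 j); rewrite liftK -dj.
  by case: pselect => // nMu; have := nMu (oMf _ fu).
have [Mc fc] := cP.
pose idx u : 'I_m.+1 := if [pick i | `[< u = c i >]] is Some i then i else ord0.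
have idxP u : params f u -> c (idx u) = u.
  move=> /fc[i ui]; rewrite /idx; case: pickP => [j /asboolP//|/(_ i)].
  by rewrite ui => /asboolP.
pose g (x : (I + 'I_n) + U) : I + 'I_(n + m.+1) :=
  match x with
  | inl (inl x) => inl x
  | inl (inr i) => inr (lshift _ i)
  | inr u => inr (rshift _ (idx u))
  end.
pose ext (a : 'I_n -> U) : 'I_(n + m.+1) -> U :=
  fun i => match fintype.split i with inl j => a j | inr j => c j end.
have plugE a' : plug a' f = plug (ext a') (no_params (rename g f)).
  rewrite /plug /no_params !rename_comp; apply: eq_rename => -[[x|i]|u] fx //=.
    by rewrite /ext (unsplitK (inl i)).
  by rewrite /ext (unsplitK (inr _)) idxP.
rewrite !plugE; apply: inv => h oMh.
(* Extending [a] and [b] by the same points [c] of [M] preserves equivalence over [M]: [k] turns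
   these points back into parameters. *)
pose k (x : 'I_(n + m.+1) + U) : 'I_n + U :=
  match x with
  | inl i => match fintype.split i with inl j => inl j | inr j => inr (c j) end
  | inr u => inr u
  end.
have satE a' : sat (assign (ext a') id) h = sat (assign a' id) (rename k h).
  rewrite sat_rename; congr sat; apply/funext => -[i|//] /=.
  by rewrite /ext; case: fintype.split.
rewrite !satE; apply: ab; apply: params_in_rename oMh _ _ => [x u kx [i xi]|v u [->]//].
by move: kx; rewrite xi /=; case: fintype.split => // j [<-].
Qed.

(** Realizations of the same type are equivalent over [M], so invariance makes the choice inside
    [fiber] immaterial. *)
Lemma fiberE n (f : formula L ((I + 'I_n) + U)) (q : borel_stone U 'I_n M) b :
  params_in M f -> realizes b q -> fiber mu f q = mu (plug b f).
Proof.
move=> oMf bq; apply: fiber_unique => // c cq; apply: plug_invariant => //.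
exact: realizes_equiv_over cq bq.
Qed.

End invariant.

Lemma morleyE {I J : Type} (M : set U) (mu : formula L (I + U) -> R)
    (nu : formula L (J + U) -> R) f : params_in M f ->
  morley M mu nu f = \int[borel_extension M nu]_q fiber mu f q.
Proof. by move=> oMf; rewrite /morley/=; have -> : M `|` params f = M by exact/setUidPl. Qed.

Lemma borel_extensionP {I : Type} (M : set U) (nu : formula L (I + U) -> R) :
  is_borel_extension nu (borel_extension M nu) \/ borel_extension M nu = mzero.
Proof. by rewrite /borel_extension; case: pselect => [h|_]; [left; case: cid|right]. Qed.

End keisler_facts.

(** * Morley powers *)

Section powers.
Context {R : realType} {L : language} {U : structure L} (M : set U).
Context (mu : formula L ('I_1 + U) -> R) (P : probability (borel_stone U nat setT) R).
Hypothesis M0 : M !=set0.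
Hypothesis satM : forall n (p : stone U 'I_n M), exists b, realizes b p.
Hypothesis kmu : is_keisler mu.
Hypothesis exc : excellent M mu.
Hypothesis path : is_path_measure M mu P.

Let inv : invariant_over M mu.
Proof. by have [[bd _] _] := exc; have [] := bd 0%N. Qed.

Local Notation lam n := (borel_extension M (power M mu n)).

Lemma power_top n : power M mu n FTop = 1.
Proof.
have [_ pathP] := path; have := pathP n FTop.
rewrite (_ : cylinder _ _ = setT) ?probability_setT; first by case.
by apply/seteqP; split=> // p _; exact: formulas_Top.
Qed.

Lemma params_in_Top {I : Type} (A : set U) : params_in A (FTop : formula L (I + U)).
Proof. by move=> u []. Qed.

(** Existence of the extension is read off the path measure: were [borel_extension] the default
    [mzero], the next power would vanish on [FTop], where [P] gives it the value 1. *)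
Lemma borel_extension_powerP n : is_borel_extension (power M mu n) (lam n).
Proof.
have [//|e] := borel_extensionP M (power M mu n).
have := power_top n.+1; rewrite /= morleyE; last exact: params_in_Top.
by rewrite e /Rintegral integral_measure_zero => /eqP; rewrite eq_sym oner_eq0.
Qed.

Lemma borel_extension_cylinder n f : params_in M f ->
  lam n (cylinder M f) = (power M mu n f)%:E.
Proof. by have [_] := borel_extension_powerP n; apply. Qed.

Lemma borel_extension_setT n : lam n setT = 1%E.
Proof.
rewrite -(_ : cylinder M FTop = setT); last first.
  by apply/seteqP; split=> // p _; exact: formulas_Top.
by rewrite borel_extension_cylinder ?power_top//; exact: params_in_Top.
Qed.

Lemma measurable_fiber n (f : formula L (('I_1 + 'I_n) + U)) : params_in M f ->
  measurable_fun setT (fiber (A := M) mu f).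
Proof. by move=> oMf; have [[bd _] _] := exc; have [_ h] := bd 0%N; exact: h. Qed.

Lemma fiberP n (f : formula L (('I_1 + 'I_n) + U)) (q : borel_stone U 'I_n M) :
  params_in M f -> exists2 b, realizes b q & fiber mu f q = mu (plug b f).
Proof. by move=> oMf; have [b bq] := satM q; exists b => //; exact: fiberE. Qed.

Lemma fiber_ge0 n (f : formula L (('I_1 + 'I_n) + U)) (q : borel_stone U 'I_n M) :
  params_in M f -> 0 <= fiber mu f q.
Proof. by move=> /(fiberP q)[b _ ->]; exact: keisler_ge0. Qed.

Lemma fiber_le1 n (f : formula L (('I_1 + 'I_n) + U)) (q : borel_stone U 'I_n M) :
  params_in M f -> fiber mu f q <= 1.
Proof. by move=> /(fiberP q)[b _ ->]; exact: keisler_le1. Qed.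

(** Fibers lie between 0 and 1 and the total mass is 1, so the integral is finite and the
    real-valued one in [morley] loses nothing. *)
Lemma integral_fiberE n (f : formula L ('I_n.+2 + U)) : params_in M f ->
  (\int[lam n]_q (fiber mu (rename_vars last_first f) q)%:E = (power M mu n.+1 f)%:E)%E.
Proof.
move=> oMf; have oMf' := params_rename_vars (s := @last_first n.+1) oMf.
rewrite /= morleyE// /Rintegral fineK// ge0_fin_numE; last first.
  by apply: integral_ge0 => q _; rewrite lee_fin fiber_ge0.
apply: (@le_lt_trans _ _ (\int[lam n]_q (cst 1%E q))%E).
  apply: ge0_le_integral => //.
  - by move=> q _; rewrite lee_fin fiber_ge0.
  - by apply/measurable_EFinP; exact: measurable_fiber.
  - by move=> q _; rewrite lee_fin fiber_le1.
by rewrite integral_cst// borel_extension_setT mule1 ltry.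
Qed.

(** When the formula ignores the last variable, its fiber takes only the values 0 and 1 and is the
    indicator of the cylinder of [f]. *)
Lemma power_marginal n (f : formula L ('I_n.+1 + U)) : params_in M f ->
  power M mu n.+1 (rename_vars (lift ord_max) f) = power M mu n f.
Proof.
move=> oMf; apply: EFin_inj.
rewrite -integral_fiberE; last exact: params_rename_vars.
rewrite rename_vars_comp -borel_extension_cylinder//.
rewrite -[X in lam n X](setIT (cylinder M f)) -integral_indic//; last exact: measurable_cylinder.
apply: eq_integral => q _; congr (_%:E).
have [|b bq ->] := @fiberP _ (rename_vars (last_first \o lift ord_max) f) q.
  exact: params_rename_vars.
have satE (a : 'I_1 -> U) :
    sat (assign a id) (plug b (rename_vars (last_first \o lift ord_max) f)) =
    sat (assign b id) f.
  rewrite sat_plug sat_rename_vars; congr sat; apply/funext => -[i|//] /=.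
  by rewrite /last_first liftK.
have := stone_realized bq oMf; rewrite indicE.
have [qf|nqf] := pselect (formulas q f) => qP.
  rewrite mem_set//= -(keisler_top kmu); apply: keisler_equiv => // a.
  by rewrite satE; split=> [_ //|_]; apply/qP.
rewrite memNset//= mulr0n -(keisler_bot kmu); apply: keisler_equiv => // a.
by rewrite satE; split=> // /qP.
Qed.

(** The fiber of the renamed formula at [q] is the fiber of [f] at the pullback of [q] along [s],
    and pulling back along [s] preserves the measure. *)
Lemma power_restr_last n (s : 'I_n.+1 -> 'I_n.+1) (f : formula L ('I_n.+2 + U)) :
  (forall g, params_in M g -> power M mu n (rename_vars s g) = power M mu n g) ->
  params_in M f ->
  power M mu n.+1 (rename_vars
    (fun i => if unlift ord_max i is Some j then lift ord_max (s j) else ord_max) f) =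
  power M mu n.+1 f.
Proof.
move=> sP oMf; apply: EFin_inj; rewrite -!integral_fiberE//; last exact: params_rename_vars.
have [reg _] := borel_extension_powerP n.
rewrite [RHS](integral_restr (s := s) (subset_refl (A := M)) reg reg); first last.
- by move=> q; apply: fiber_ge0; exact: params_rename_vars.
- by apply: measurable_fiber; exact: params_rename_vars.
- move=> g oMg; rewrite !borel_extension_cylinder ?sP//; exact: params_rename_vars.
- exact: borel_extension_setT.
apply: eq_integral => q _; congr (_%:E).
have [b bq] := satM q.
rewrite (fiberE M0 inv _ bq); last by do 2 apply: params_rename_vars.
rewrite (fiberE M0 inv _ (realizes_restr (AB := subset_refl (A := M)) bq)); last exact: params_rename_vars.
congr mu; rewrite /plug /rename_vars !rename_comp; congr rename; apply/funext => -[i|//] /=.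
by have [j ->|->] := unliftP ord_max i; rewrite /last_first ?liftK ?unlift_none /= ?liftK ?unlift_none.
Qed.

End powers.

(** * Transposing the last two variables *)

Section swap.
Context {R : realType} {L : language} {U : structure L} (M : set U).

Lemma rename_vars_params {I J : Type} (s : I -> J) (f : formula L (I + U)) :
  params (rename_vars s f) = params f.
Proof.
apply/seteqP; split=> u /= fu; last exact: (occurs_rename_inv (assign (inl \o s) inr) fu).
by have [[//|v] /= fv [->]] := occurs_rename fu.
Qed.

Lemma morley_rename_left {I J : Type} (mu : formula L (I + U) -> R)
    (nu : formula L (J + U) -> R) (s : I -> I) (f : formula L ((I + J) + U)) :
  (forall g, mu (rename_vars s g) = mu g) ->
  morley M mu nu (rename_vars (assign (inl \o s) inr) f) = morley M mu nu f.
Proof.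
move=> sP; rewrite /morley/= rename_vars_params; congr Rintegral.
apply/funext => q; rewrite /fiber; congr xget; apply: eq_imagel => b _.
by rewrite (plug_rename_vars b s id) sP.
Qed.

(** A convenient right factor for [power_swap]; adequacy identifies all parenthesizations with the
    same number of leaves. *)
Fixpoint right_comb n := if n is m.+1 then Node Leaf (right_comb m) else Leaf.

Lemma leaves_right_comb n : leaves (right_comb n) = n.+1.
Proof. by elim: n => //= n ->; rewrite addn1. Qed.

Lemma val_tperm k (a b i : 'I_k) : tperm a b i =
  (if val i == val a then val b else if val i == val b then val a else val i) :> nat.
Proof.
case: tpermP => [->|->|/eqP ia /eqP ib]; rewrite ?eqxx//; first by case: eqP.
by rewrite !(inj_eq val_inj) (negPf ia) (negPf ib).
Qed.

Lemma ordinal_2_cases (i : 'I_2) : i = ord0 \/ i = ord_max.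
Proof. by case: i => -[|[|//]] h; [left|right]; exact: val_inj. Qed.

Context (mu : formula L ('I_1 + U) -> R) (exc : excellent M mu).

Lemma iterated_pair_swap (f : formula L ('I_2 + U)) :
  iterated M mu (Node Leaf Leaf) (rename_vars (@rev_ord 2) f) =
  iterated M mu (Node Leaf Leaf) f.
Proof.
have [_ com] := exc; rewrite /= [RHS]com !rename_vars_comp.
congr (morley M mu mu (rename_vars _ _)); apply/funext => i /=.
have e0 : @ord0 1 = @lshift 1 1 ord0 by exact: val_inj.
have e1 : @ord_max 1 = @rshift 1 1 ord0 by exact: val_inj.
have r0 : rev_ord (@lshift 1 1 ord0) = @rshift 1 1 ord0 by exact: val_inj.
have r1 : rev_ord (@rshift 1 1 ord0) = @lshift 1 1 ord0 by exact: val_inj.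
have [->|->] := ordinal_2_cases i; rewrite ?e0 ?e1 ?r0 ?r1.
  by rewrite (unsplitK (inl ord0)) (unsplitK (inr ord0)).
by rewrite (unsplitK (inl ord0)) (unsplitK (inr ord0)).
Qed.

(** For two variables this is commutativity. Otherwise adequacy regroups the product so that the
    last two copies of [mu] form the left factor; that factor is symmetric by excellence, and a
    symmetry of the left factor passes to the product. *)
Lemma power_swap n (f : formula L ('I_n.+2 + U)) :
  power M mu n.+1 (rename_vars (tperm (lift ord_max ord_max) ord_max) f) = power M mu n.+1 f.
Proof.
have [[_ adq] com] := exc; case: n f => [|n] f.
  rewrite /= [RHS]com !rename_vars_comp; congr (morley M mu mu (rename_vars _ _)).
  apply/funext => i /=; have [->|->] := ordinal_2_cases i; rewrite /last_first.
    rewrite (_ : ord0 = lift ord_max ord_max); last exact: val_inj.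
    by rewrite tpermL unlift_none liftK /= [ord_max]ord1.
  by rewrite tpermR unlift_none liftK /= [ord_max]ord1.
pose t := Node (Node Leaf Leaf) (right_comb n).
have e : leaves t = n.+3 by rewrite /= leaves_right_comb addn2.
(* [leaves t] equals [n.+3] only propositionally, so both the formula and the transposition are
   transported along [e]. *)
pose f' := rename_vars (cast_ord (esym e)) f.
have ff' : f = rename_vars (cast_ord e) f'.
  rewrite rename_vars_comp -[LHS]rename_vars_id; congr rename_vars.
  by apply/funext => i /=; rewrite cast_ordKV.
move: ff'; move: f' => f' ff'.
pose tau := cast_ord (esym e) \o tperm (lift ord_max ord_max) ord_max \o cast_ord e.
have -> : rename_vars (tperm (lift ord_max ord_max) ord_max) f =
    rename_vars (cast_ord e) (rename_vars tau f').
  rewrite {1}ff' !rename_vars_comp; congr rename_vars.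
  by apply/funext => i /=; rewrite !cast_ordKV.
have iterE g : iterated M mu t g = morley M (iterated M mu (Node Leaf Leaf))
    (iterated M mu (right_comb n)) (rename_vars (fun i => swap_sum (fintype.split i)) g).
  by [].
rewrite ff' -!adq !iterE.
rewrite -[RHS](morley_rename_left _ _ iterated_pair_swap) !rename_vars_comp.
congr (morley _ _ _ (rename_vars _ _)); apply/funext => i.
change (swap_sum (fintype.split (tau i)) =
  assign (inl \o @rev_ord 2) inr (swap_sum (@fintype.split (leaves (right_comb n)) 2 i))).
have m1 := leaves_right_comb n.
have tauE (x : 'I_(leaves t)) : tau x = (if val x == n.+1 then n.+2 else
    if val x == n.+2 then n.+1 else val x) :> nat.
by rewrite /tau /= val_tperm /= /bump ltnn.
have [j ij|k ik] := @splitP (leaves (right_comb n)) 2 i.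
  have -> : tau i = @lshift (leaves (right_comb n)) 2 j.
    apply: ord_inj; rewrite tauE /= ij.
    have jn : (j < n.+1)%N by rewrite -[X in (_ < X)%N]m1.
    by rewrite !ltn_eqF// ltnW.
  by rewrite (unsplitK (inl j)).
(* On the block of the last two variables the transposition is the reversal. *)
have -> : tau i = @rshift (leaves (right_comb n)) 2 (rev_ord k).
  apply: ord_inj; rewrite tauE /= ik /=.
  case: k {ik} => -[|[|//]] kk /=; rewrite ?m1; do 2?case: eqP => //; lia.
by rewrite (unsplitK (inr _)).
Qed.
End swap.

(** * Exchangeability *)

(** Serves to factor an injection of variables as the initial inclusion, handled by marginals,
    followed by a permutation. *)
Lemma perm_extending (T : finType) n (w s : 'I_n -> T) :
  injective w -> injective s -> exists p : {perm T}, forall i, p (w i) = s i.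
Proof.
move=> wI sI; suff /(_ n (leqnn n))[p pP] : forall k, (k <= n)%N ->
    exists p : {perm T}, forall i : 'I_n, (i < k)%N -> p (w i) = s i.
  by exists p => i; exact: pP.
elim=> [|k IH] kn; first by exists 1%g.
have [p pP] := IH (ltnW kn); pose j := Ordinal kn.
(* The transposition corrects the value at [w j]; by injectivity it leaves the values already
   prescribed alone. *)
exists (p * tperm (p (w j)) (s j))%g => i; rewrite ltnS leq_eqVlt permM => /orP[/eqP ik|ik].
  by rewrite (_ : i = j) ?tpermL//; exact: ord_inj.
have ij : j != i by rewrite -(inj_eq val_inj) /= gtn_eqF.
rewrite (pP i)// tpermD//; last by rewrite (inj_eq sI).
by rewrite -(pP i)// (inj_eq perm_inj) (inj_eq wI).
Qed.

Section exchangeability.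
Context {R : realType} {L : language} {U : structure L} (M : set U).
Context (mu : formula L ('I_1 + U) -> R) (P : probability (borel_stone U nat setT) R).
Hypothesis M0 : M !=set0.
Hypothesis satM : forall n (p : stone U 'I_n M), exists b, realizes b p.
Hypothesis kmu : is_keisler mu.
Hypothesis exc : excellent M mu.
Hypothesis path : is_path_measure M mu P.

Let power_perm_fix n (s : 'I_n.+2 -> 'I_n.+2) (f : formula L ('I_n.+2 + U)) :
  (forall (t : 'I_n.+1 -> 'I_n.+1) g, injective t -> params_in M g ->
    power M mu n (rename_vars t g) = power M mu n g) ->
  injective s -> s ord_max = ord_max -> params_in M f ->
  power M mu n.+1 (rename_vars s f) = power M mu n.+1 f.
Proof.
move=> IH sI smax oMf.
(* The default [j] is never reached: [s] is injective and fixes [ord_max], so it maps the other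
   variables among themselves. *)
pose t j := if unlift ord_max (s (lift ord_max j)) is Some k then k else j.
have tE j : lift ord_max (t j) = s (lift ord_max j).
  rewrite /t; case: unliftP => [k //|/esym]; rewrite -[in LHS]smax => /sI e.
  by have := neq_lift ord_max j; rewrite -e eqxx.
have tI : injective t.
  by move=> i j e; apply: (@lift_inj _ ord_max); apply: sI; rewrite -!tE e.
rewrite -[RHS](power_restr_last M0 satM kmu exc path (s := t))//; last first.
  by move=> g; exact: IH.
congr (power _ _ _ (rename_vars _ _)); apply/funext => i.
by case: unliftP => [j ->|->]; rewrite ?tE.
Qed.

Lemma power_perm n (s : 'I_n.+1 -> 'I_n.+1) (f : formula L ('I_n.+1 + U)) :
  injective s -> params_in M f -> power M mu n (rename_vars s f) = power M mu n f.
Proof.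
elim: n s f => [|n IH] s f sI oMf.
  rewrite (_ : s = id) ?rename_vars_id//; apply/funext => i.
  by rewrite [LHS]ord1 [RHS]ord1.
have [smax|smax] := eqVneq (s ord_max) ord_max; first exact: power_perm_fix.
have [j sj|sj] := unliftP ord_max (s ord_max); last by rewrite sj eqxx in smax.
(* With [pen] the penultimate variable, [u] exchanges it with the image of the last variable and
   [tp] exchanges it with the last one. Then [r] fixes the last variable and [s] is [u \o tp \o r]:
   the induction hypothesis handles [u] and [r], and [power_swap] handles [tp]. *)
pose pen : 'I_n.+2 := lift ord_max ord_max.
pose u := tperm (lift ord_max j) pen; pose tp := tperm pen ord_max.
pose r := tp \o u \o s.
have -> : s = u \o (tp \o r) by apply/funext => i; rewrite /r /= /tp /u !tpermK.
have oMr : params_in M (rename_vars r f) by exact: params_rename_vars.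
have rI : injective r by move=> x y /perm_inj/perm_inj/sI.
have rmax : r ord_max = ord_max by rewrite /r /= sj /u tpermL /tp tpermL.
have umax : u ord_max = ord_max.
  by rewrite /u tpermD// eq_sym neq_lift.
rewrite -(rename_vars_comp u (tp \o r)) -(rename_vars_comp tp r) (power_perm_fix IH perm_inj umax); last exact: params_rename_vars.
by rewrite power_swap// power_perm_fix.
Qed.

Let power_widen k n (w : 'I_n.+1 -> 'I_(k + n).+1) (f : formula L ('I_n.+1 + U)) :
  (forall i, w i = i :> nat) -> params_in M f ->
  power M mu (k + n) (rename_vars w f) = power M mu n f.
Proof.
elim: k w => [|k IH] w wP oMf.
  by rewrite (_ : w = id) ?rename_vars_id//; apply/funext => i; apply: ord_inj; exact: wP.
pose w' (i : 'I_n.+1) : 'I_(k + n).+1 := inord i.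
have w'P i : w' i = i :> nat.
  by rewrite /w' inordK// (leq_trans (ltn_ord i))// ltnS leq_addl.
have -> : w = lift ord_max \o w'.
  apply/funext => i; apply: ord_inj; rewrite wP /= w'P /bump leqNgt.
  by rewrite (leq_trans (ltn_ord i))// ltnS leq_addl.
rewrite -(IH w')// -rename_vars_comp (power_marginal M0 satM kmu exc path)//.
exact: params_rename_vars.
Qed.

Lemma power_injection n m (s : 'I_n.+1 -> 'I_m.+1) (f : formula L ('I_n.+1 + U)) :
  injective s -> params_in M f -> power M mu m (rename_vars s f) = power M mu n f.
Proof.
move=> sI oMf; have := leq_card s sI; rewrite !card_ord ltnS => nm.
have [k mk] : exists k, m = (k + n)%N by exists (m - n)%N; rewrite subnK.
subst m; pose w (i : 'I_n.+1) : 'I_(k + n).+1 := inord i.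
have wP i : w i = i :> nat.
  by rewrite /w inordK// (leq_trans (ltn_ord i))// ltnS leq_addl.
have wI : injective w by move=> i j /(congr1 val); rewrite /= !wP => /ord_inj.
have [p pP] := perm_extending wI sI.
have -> : s = p \o w by apply/funext => i /=; rewrite pP.
rewrite -rename_vars_comp power_perm; [exact: power_widen|exact: perm_inj|].
exact: params_rename_vars.
Qed.

Lemma path_measure_injection n (s : 'I_n.+1 -> nat) (f : formula L ('I_n.+1 + U)) :
  injective s -> params_in M f ->
  P (cylinder setT (rename_vars s f)) = (power M mu n f)%:E.
Proof.
move=> sI oMf; pose m := (\max_i s i)%N; pose s' (i : 'I_n.+1) : 'I_m.+1 := inord (s i).
have s'P i : s' i = s i :> nat by rewrite inordK// ltnS leq_bigmax.
have -> : s = @nat_of_ord m.+1 \o s' by apply/funext => i /=; rewrite s'P.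
have [_ pathP] := path; rewrite -rename_vars_comp pathP power_injection//.
by move=> i j /(congr1 val); rewrite /= !s'P => /sI.
Qed.

End exchangeability.

(** * The extension axiom *)

Section extension.
Context {R : realType} {L : language} {U : structure L} (M : set U).
Context (mu : formula L ('I_1 + U) -> R) (P : probability (borel_stone U nat setT) R).
Hypothesis M0 : M !=set0.
Hypothesis satM : forall n (p : stone U 'I_n M), exists b, realizes b p.
Hypothesis kmu : is_keisler mu.
Hypothesis exc : excellent M mu.
Hypothesis path : is_path_measure M mu P.

Let inv : invariant_over M mu.
Proof. by have [[bd _] _] := exc; have [] := bd 0%N. Qed.

(** In the application [e] is the diagram of a tuple and [d] the negated diagram of a one-point
    extension. The tuple sits at the coordinates [tau 0], ..., [tau n] of the path, and candidate
    number [k], counted from 0, at [tau (k + n).+1]. *)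
Context (n : nat) (e : formula L ('I_n.+1 + U)) (d : formula L ('I_n.+2 + U)).
Context (tau : nat -> nat).
Hypothesis oMe : params_in M e.
Hypothesis oMd : params_in M d.
Hypothesis tauI : injective tau.

Definition widen k (i : 'I_n.+1) : 'I_(k + n).+1 := inord i.
Definition widen_last k (i : 'I_n.+2) : 'I_(k + n).+2 :=
  if unlift ord_max i is Some j then lift ord_max (widen k j) else ord_max.

(* [e] holds of the first [n.+1] variables, and each of the next [k] variables,
   the candidates, satisfies [d] over them. *)
Fixpoint misses k : formula L ('I_(k + n).+1 + U) :=
  match k return formula L ('I_(k + n).+1 + U) with
  | 0 => e
  | k.+1 => FAnd (rename_vars (lift ord_max) (misses k)) (rename_vars (widen_last k) d)
  end.

Lemma val_widen k i : widen k i = i :> nat.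
Proof. by rewrite /widen inordK// (leq_trans (ltn_ord i))// ltnS leq_addl. Qed.

Lemma params_misses k : params_in M (misses k).
Proof.
elim: k => [//|k IH]; apply: params_in_And; exact: params_rename_vars.
Qed.

Let pi : borel_stone U nat setT -> borel_stone U 'I_n.+1 M :=
  restr (tau \o val) (@subsetT _ M).
(** The conditional probability, given the type of the tuple, that a fresh candidate satisfies
    [d]. *)
Let F : borel_stone U 'I_n.+1 M -> R := fiber mu (rename_vars last_first d).
Let S k : set (borel_stone U nat setT) := cylinder setT (rename_vars (tau \o val) (misses k)).

Let mS k : measurable (S k).
Proof. by apply: measurable_cylinder; apply: params_rename_vars => u _. Qed.

Let mpi : measurable_fun setT pi. Proof. exact: measurable_restr. Qed.

Let mF : measurable_fun setT F.
Proof. by apply: (measurable_fiber exc); exact: params_rename_vars. Qed.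

Let F0 q : 0 <= F q.
Proof. by apply: (fiber_ge0 M0 satM kmu exc); exact: params_rename_vars. Qed.

Let F1 q : F q <= 1.
Proof. by apply: (fiber_le1 M0 satM kmu exc); exact: params_rename_vars. Qed.

Let lift_val k : tau \o val \o lift ord_max = tau \o val :> ('I_k -> nat).
Proof. by apply/funext => i /=; rewrite /bump leqNgt ltn_ord. Qed.

Let S_succ k p : S k.+1 p <-> S k p /\ formulas p (rename_vars (tau \o val \o widen_last k) d).
Proof.
rewrite /S /cylinder /= -[rename_vars _ (FAnd _ _)]/(FAnd (rename_vars _ _) (rename_vars _ _)).
rewrite stone_And; try by move=> u _.
by rewrite !rename_vars_comp lift_val.
Qed.

Let P_S k : P (S k) = (power M mu (k + n) (misses k))%:E.
Proof.
rewrite /S (path_measure_injection M0 satM kmu exc path)//; last exact: params_misses.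
by apply: inj_comp => //; exact: val_inj.
Qed.

(** The newest candidate is a fresh sample from [mu] over all earlier coordinates. Its fiber
    factors: [S k] is decided by those coordinates and contributes an indicator, while [d] involves
    only the tuple and contributes [F]. *)
Let P_S_succ k : P (S k.+1) = (\int[P]_p (\1_(S k) p * F (pi p))%:E)%E.
Proof.
have oM := @params_misses k.+1.
rewrite P_S -(integral_fiberE M0 satM kmu exc path)//.
have [reg cylP] := borel_extension_powerP path (k + n).
have [regP _] := path.
rewrite (integral_restr (s := tau \o val) (@subsetT _ M) reg regP); first last.
- by move=> q; apply: (fiber_ge0 M0 satM kmu exc); exact: params_rename_vars.
- by apply: (measurable_fiber exc); exact: params_rename_vars.
- move=> f oMf; rewrite cylP//; apply: (path_measure_injection M0 satM kmu exc path) => //.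
  by apply: inj_comp => //; exact: val_inj.
- exact: probability_setT.
apply: eq_integral => p _; congr (_%:E).
set q := restr _ _ p; have [b bq] := satM q.
(* [b] realizes the type of the tuple together with the first [k] candidates, so its initial segment
   realizes the type of the tuple. *)
have bpi : realizes (b \o widen k) (pi p).
  move=> f [oMf pf]; rewrite -sat_rename_vars; apply: bq; split.
    exact: params_rename_vars.
  rewrite rename_vars_comp (_ : _ \o _ = tau \o val)//.
  by apply/funext => i /=; rewrite val_widen.
rewrite (fiberE M0 inv _ bq); last exact: params_rename_vars.
rewrite /F (fiberE M0 inv _ bpi); last exact: params_rename_vars.
have satS (a : 'I_1 -> U) :
    sat (assign a id) (plug b (rename_vars last_first (misses k.+1))) <->
    S k p /\ sat (assign a id) (plug (b \o widen k) (rename_vars last_first d)).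
  rewrite !sat_plug !sat_rename_vars -[misses k.+1]/(FAnd _ _) sat_And !sat_rename_vars.
  have -> : S k p <-> sat (assign b id) (misses k).
    rewrite -(stone_realized bq); last exact: params_misses.
    by split=> [pS|[]//]; split=> //; exact: params_misses.
  rewrite (_ : _ \o lift ord_max = b); last by apply/funext => i /=; rewrite /last_first liftK.
  rewrite (_ : _ \o widen_last k = assign a (b \o widen k) \o last_first)//.
  apply/funext => i /=; rewrite /widen_last /last_first.
  by case: (unliftP ord_max i) => [j _|_]; rewrite ?liftK ?unlift_none.
rewrite indicE; have [pS|npS] := pselect (S k p).
  rewrite mem_set// mul1r; apply: (keisler_equiv kmu) => a; rewrite satS.
  by split=> [[]|].
rewrite memNset// mul0r -(keisler_bot kmu); apply: (keisler_equiv kmu) => a.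
by rewrite satS; split=> [[]|].
Qed.

Let Sinf : set (borel_stone U nat setT) := \bigcap_k S k.

Let mSinf : measurable Sinf. Proof. exact: bigcap_measurable. Qed.

Let gap (X : set (borel_stone U nat setT)) p := \1_X p * (1 - F (pi p)).

Let gap_ge0 X p : 0 <= gap X p.
Proof. by rewrite mulr_ge0// subr_ge0. Qed.

Let mgap X : measurable X -> measurable_fun setT (gap X).
Proof.
move=> mX; apply: measurable_funM; first exact: measurable_indic.
by apply: measurable_funB => //; exact: measurableT_comp.
Qed.

Let P_S_gap k : (P (S k.+1) + \int[P]_p (gap (S k) p)%:E = P (S k))%E.
Proof.
rewrite P_S_succ -ge0_integralD//.
- rewrite -[X in _ = P X](setIT (S k)) -integral_indic//; apply: eq_integral => p _.
  by rewrite -EFinD /gap -mulrDr addrC subrK mulr1.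
- by move=> p _; rewrite lee_fin mulr_ge0.
- apply/measurable_EFinP; apply: measurable_funM; first exact: measurable_indic.
  exact: measurableT_comp.
- by move=> p _; rewrite lee_fin.
- by apply/measurable_EFinP; exact: mgap.
Qed.

(** Since [Sinf] lies in every [S k], the probability of [S k] drops by at least this integral at
    each step; infinitely many drops of a fixed positive size are impossible. *)
Let integral_gap : (\int[P]_p (gap Sinf p)%:E = 0)%E.
Proof.
have gap_le k : (P (S k.+1) + \int[P]_p (gap Sinf p)%:E <= P (S k))%E.
  rewrite -(P_S_gap k); apply: leeD => //; apply: ge0_le_integral => //.
  - by move=> p _; rewrite lee_fin.
  - by apply/measurable_EFinP; exact: mgap.
  - by apply/measurable_EFinP; exact: mgap.
  - move=> p _; rewrite lee_fin ler_wpM2r ?subr_ge0// !indicE.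
    have [pS|npS] := pselect (Sinf p); last by rewrite (memNset npS).
    by rewrite !mem_set//; exact: pS.
have : (0 <= \int[P]_p (gap Sinf p)%:E)%E.
  by apply: integral_ge0 => p _; rewrite lee_fin.
move: gap_le; case: (\int[P]_p _)%E => [r||] //; last first.
  by move=> /(_ 0%N); rewrite !P_S.
move=> gap_le; rewrite lee_fin le_eqVlt => /orP[/eqP<-//|r0]; exfalso.
pose x k := power M mu (k + n) (misses k).
have x_le k : x k + r * k%:R <= x 0%N.
  elim: k => [|k IH]; first by rewrite mulr0 addr0.
  apply: le_trans IH; have := gap_le k; rewrite !P_S lee_fin -/(x _) -/(x _) => h.
  by rewrite -natr1 mulrDr mulr1; lra.
have x_ge0 k : 0 <= x k by rewrite -lee_fin -P_S.
(* After more than [x 0 / r] steps the accumulated drops exceed the initial probability. *)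
have /archi_boundP : 0 <= x 0%N / r by rewrite divr_ge0// ltW.
rewrite ltr_pdivrMr// mulrC ltNge => /negP; apply.
by apply: le_trans (x_le (Num.bound (x 0%N / r))); rewrite lerDr.
Qed.

Hypothesis null : borel_extension M (power M mu n)
  (cylinder M e `&` [set q | fiber mu (rename_vars last_first d) q = 1]) = 0%E.

(** A path in [Sinf] almost surely has [F (pi p) = 1], because [gap Sinf] is nonnegative with
    integral 0. The hypothesis [null], pulled back along [pi], excludes this value almost surely
    when [e] holds. *)
Lemma ae_not_always_missed : {ae P, forall p : borel_stone U nat setT,
  formulas p (rename_vars (tau \o val) e) ->
  exists k, ~ formulas p (rename_vars (tau \o val \o widen_last k) d)}.
Proof.
have mF1 : measurable [set q | F q = 1].
  by have := mF measurableT (measurable_set1 (1 : R)); rewrite setTI.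
have : P.-negligible (pi @^-1` (cylinder M e `&` [set q | F q = 1])).
  exists (pi @^-1` (cylinder M e `&` [set q | F q = 1])); split=> //.
    rewrite -[X in measurable X]setTI; apply: mpi => //; apply: measurableI => //.
    exact: measurable_cylinder.
  have [reg cylP] := borel_extension_powerP path n; have [regP _] := path.
  rewrite (regular_pushforward _ reg regP)//.
  - exact: probability_setT.
  - move=> f oMf; rewrite cylP//; apply: (path_measure_injection M0 satM kmu exc path) => //.
    by apply: inj_comp => //; exact: val_inj.
  - by apply: measurableI => //; exact: measurable_cylinder.
have : ae_eq P setT (EFin \o gap Sinf) (cst 0%E).
  apply/ae_eq_integral_abs => //; first by apply/measurable_EFinP; exact: mgap.
  rewrite -[RHS]integral_gap; apply: eq_integral => p _ /=.
  by rewrite ger0_norm.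
move=> ae1 [X [mX PX0 nullX]].
have ae2 : {ae P, forall p, ~ (pi @^-1` (cylinder M e `&` [set q | F q = 1])) p}.
  by exists X; split=> // p /= /contrapT; exact: nullX.
apply: filterS2 ae1 ae2 => p.
move=> /= /(_ Logic.I)[gap0] not1 pe; apply: contrapT => /forallNP all.
have pS : Sinf p.
  move=> k _; elim: k => [//|k IH]; apply/S_succ; split=> //.
  exact: contrapT (all k).
apply: not1; split; first by split=> //.
by move: gap0; rewrite /gap indicE mem_set// mul1r => /eqP; rewrite subr_eq0 => /eqP.
Qed.

End extension.

(** * Diagrams *)

Section diagrams.
Context {L : language}.

Definition snoc {S : Type} n (v : 'I_n -> S) (c : S) (i : 'I_n.+1) : S :=
  if unlift ord_max i is Some j then v j else c.

Lemma snoc_lift {S : Type} n (v : 'I_n.+1 -> S) : snoc (v \o lift ord_max) (v ord_max) = v.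
Proof. by apply/funext => i; rewrite /snoc; case: unliftP => [j ->|->]. Qed.

Lemma snocK {S : Type} n (v : 'I_n -> S) c : snoc v c \o lift ord_max = v.
Proof. by apply/funext => i; rewrite /snoc /= liftK. Qed.

Lemma snoc_max {S : Type} n (v : 'I_n -> S) c : snoc v c ord_max = c.
Proof. by rewrite /snoc unlift_none. Qed.

Lemma comp_snoc {S S' : Type} (g : S -> S') n (v : 'I_n -> S) c :
  g \o snoc v c = snoc (g \o v) (g c).
Proof. by apply/funext => i; rewrite /snoc /=; case: unliftP. Qed.

(** The semantic side of [diag], as [sat_diag] shows, comparing tuples from different structures. *)
Definition same_diag {S S' : structure L} n (v : 'I_n -> S) (w : 'I_n -> S') : Prop :=
  (forall i j, v i = v j <-> w i = w j) /\
  (forall (r : L) (t : (arity r).-tuple 'I_n),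
     interp (map_tuple v t) <-> interp (map_tuple w t)).

Section same_diag_theory.
Context {S S' S'' : structure L}.

Lemma same_diag_sym n (v : 'I_n -> S) (w : 'I_n -> S') : same_diag v w -> same_diag w v.
Proof. by case=> e r; split=> [i j|q t]; [rewrite e|rewrite r]. Qed.

Lemma same_diag_trans n (w : 'I_n -> S') (v : 'I_n -> S) (x : 'I_n -> S'') :
  same_diag v w -> same_diag w x -> same_diag v x.
Proof.
move=> [e r] [e' r']; split=> [i j|q t]; first by rewrite e e'.
by rewrite r r'.
Qed.

Lemma same_diag_comp n m (g : 'I_m -> 'I_n) (v : 'I_n -> S) (w : 'I_n -> S') :
  same_diag v w -> same_diag (v \o g) (w \o g).
Proof.
by move=> [e r]; split=> [i j|q t]; [exact: e|have := r q (map_tuple g t); rewrite !map_tuple_comp].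
Qed.

Lemma mem_atoms n (f : formula L 'I_n) : f \in atoms n <->
  (exists i j, f = FEq i j) \/ (exists r (t : (arity r).-tuple 'I_n), f = FRel t).
Proof.
rewrite mem_cat; split.
  case/orP=> [/allpairsP[[i j] /= [_ _ ->]]|/flattenP[s /mapP[r _ ->] /mapP[t _ ->]]].
    by left; exists i, j.
  by right; exists r, t.
case=> [[i [j ->]]|[r [t ->]]]; apply/orP.
  by left; apply/allpairsP; exists (i, j); rewrite !mem_enum.
by right; apply/flatten_mapP; exists r; rewrite ?mem_enum// map_f// mem_enum.
Qed.

Lemma same_diag_atoms n (v : 'I_n -> S) (w : 'I_n -> S') :
  same_diag v w <-> forall f, f \in atoms n -> sat v f <-> sat w f.
Proof.
split=> [[e r] f /mem_atoms[[i [j ->]]|[q [t ->]]]|h]; [exact: e|exact: r|].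
split=> [i j|r t].
  by apply: (h (FEq i j)); apply/mem_atoms; left; exists i, j.
by apply: (h (FRel t)); apply/mem_atoms; right; exists r, t.
Qed.

Lemma sat_foldr_And V (v : V -> S) (s : seq (formula L V)) :
  sat v (foldr FAnd FTop s) <-> forall f, f \in s -> sat v f.
Proof.
elim: s => [|f s IH]; first by split=> // _; exact: id.
rewrite -[foldr _ _ _]/(FAnd f _) sat_And IH; split=> [[vf vs] g|h].
  by rewrite inE => /orP[/eqP->|/vs].
split=> [|g gs]; first by apply: h; rewrite mem_head.
by apply: h; rewrite inE gs orbT.
Qed.

End same_diag_theory.

Lemma sat_diag {S S' : structure L} n (v : 'I_n -> S) (w : 'I_n -> S') :
  sat w (diag v) <-> same_diag v w.
Proof.
rewrite same_diag_atoms sat_foldr_And; split=> [h f fa|h f /mapP[g ga ->]].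
  have := h _ (map_f _ fa); case: asboolP => vf /= wf; first by split.
  by split.
by case: asboolP => vg; [exact/h|move=> wg; apply: vg; exact/h].
Qed.

(** The formulas coincide syntactically: [diag] runs through the fixed list [atoms n], and truth
    values alone decide the signs. *)
Lemma diag_eq {S S' : structure L} n (v : 'I_n -> S) (w : 'I_n -> S') :
  same_diag v w -> diag v = diag w.
Proof.
move=> /same_diag_atoms h; congr foldr; apply/eq_in_map => f fa.
by rewrite (asbool_equiv_eq (h f fa)).
Qed.

(** For countable structures this one-point extension property amounts to ultrahomogeneity. *)
Definition homogeneous (S : structure L) : Prop :=
  forall n (v w : 'I_n -> S) c, same_diag v w -> exists c', same_diag (snoc v c) (snoc w c').

Lemma injective_reindexing (X : Type) n (v : 'I_n -> X) :
  exists m (i : 'I_m -> 'I_n) (r : 'I_n -> 'I_m), injective (v \o i) /\ v \o i \o r = v.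
Proof.
(* One index is chosen in each fiber of [v]; [pick] sees only the value [v x], so the choice is
   constant on fibers. *)
pose rep (x : 'I_n) : 'I_n := odflt x [pick y | `[< v y = v x >]].
have vrep x : v (rep x) = v x by rewrite /rep; case: pickP => [y /asboolP|].
have rep_eq x y : v x = v y -> rep x = rep y.
  rewrite /rep => vxy; have -> : (fun z => `[< v z = v x >]) = (fun z => `[< v z = v y >]).
    by rewrite vxy.
  by case: pickP => // /(_ y); rewrite asboolT.
pose A := [set rep x | x in [set: 'I_n]]%SET.
exists #|A|, enum_val.
have repA x : rep x \in A by exact: imset_f.
exists (fun x => enum_rank_in (repA x) (rep x)); split; last first.
  by apply/funext => x /=; rewrite enum_rankK_in.
move=> a b /=; have /imsetP[x _ ex] := enum_valP a; have /imsetP[y _ ey] := enum_valP b.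
by rewrite ex ey !vrep => /rep_eq; rewrite -ex -ey => /enum_val_inj.
Qed.

(** The measure speaks about distinct coordinates and nonempty tuples, hence this reduction:
    repeated entries are removed and reinserted, and a point already in the tuple is matched by its
    partner. *)
Lemma homogeneousP (S : structure L) :
  (forall n (v w : 'I_n.+1 -> S) c, injective v -> (forall i, v i <> c) -> same_diag v w ->
     exists c', same_diag (snoc v c) (snoc w c')) -> homogeneous S.
Proof.
move=> h n v w c vw.
have [[i vi]|/forallNP vc] := pselect (exists i, v i = c).
  exists (w i); rewrite -vi.
  have := same_diag_comp (snoc id i) vw; rewrite !comp_snoc; exact.
have [m [g [r [vgI vgr]]]] := injective_reindexing v.
have wgr : w \o g \o r = w.
  by apply/funext => x; apply/(proj1 vw); rewrite -[in RHS]vgr.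
(* If the reduced tuple is empty, so are [v] and [w], and [c] answers for itself. *)
case: m g r vgI vgr wgr => [|m] g r vgI vgr wgr.
  exists c; rewrite (_ : w = v)//; apply/funext => x; by case: (r x).
have [x|c' vwc] := h m (v \o g) (w \o g) c vgI _ (same_diag_comp g vw); first exact: vc.
exists c'; have := same_diag_comp (snoc (lift ord_max \o r) ord_max) vwc.
have snocE (x : 'I_n -> S) (y : 'I_m.+1 -> S) a : y \o r = x ->
    snoc y a \o snoc (lift ord_max \o r) ord_max = snoc x a.
  by move=> <-; rewrite comp_snoc compA snocK snoc_max.
by rewrite !(snocE _ _ _ vgr) (snocE _ _ _ wgr).
Qed.

End diagrams.

(** * Transfer of the extension property between models of a theory *)

Section sentences.
Context {L : language}.

Fixpoint close n : formula L 'I_n -> formula L void :=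
  match n with
  | 0 => rename (fun i : 'I_0 => match notF (ltn_ord i) with end)
  | n.+1 => fun f => close (FAll (rename (unlift ord_max) f))
  end.

Lemma sat_FAll_last (S : structure L) n (f : formula L 'I_n.+1) (v : 'I_n -> S) :
  sat v (FAll (rename (unlift ord_max) f)) = forall a, sat (snoc v a) f.
Proof. by rewrite /=; apply: eq_forall => a; rewrite sat_rename. Qed.

Lemma sat_close (S : structure L) n (f : formula L 'I_n) :
  sat (of_void S) (close f) <-> forall v : 'I_n -> S, sat v f.
Proof.
elim: n f => [|n IH] f /=.
  rewrite sat_rename; split=> [sf v|]; last exact.
  by move: sf; congr sat; apply/funext => -[].
rewrite IH; split=> sf v; last by rewrite sat_FAll_last => a; exact: sf.
by have := sf (v \o lift ord_max); rewrite sat_FAll_last => /(_ (v ord_max)); rewrite snoc_lift.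
Qed.

Section models_of_theory.
Context {N : structure L}.

(** The theory of a structure is complete: a sentence false in [N] puts its negation into
    [theory N]. *)
Lemma models_theory (S : structure L) n (f : formula L 'I_n) : models S (theory N) ->
  (forall v : 'I_n -> S, sat v f) <-> (forall v : 'I_n -> N, sat v f).
Proof.
move=> SN; rewrite -!sat_close; split=> [Sf|Nf]; last exact: SN.
by apply: contrapT => nNf; exact: (SN (FNeg (close f)) nNf Sf).
Qed.

Context (S S' : structure L) (homN : homogeneous N).
Hypotheses (SN : models S (theory N)) (S'N : models S' (theory N)).

(** Nullary relation symbols may hold of the empty tuple; their truth is settled by the common
    theory. *)
Lemma same_diag_empty (v : 'I_0 -> S) (w : 'I_0 -> S') : same_diag v w.
Proof.
apply/sat_diag; apply: (proj2 (models_theory (diag v) S'N)).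
apply: (proj1 (models_theory (diag v) SN)) => v'.
rewrite (_ : v' = v); last by apply/funext => -[].
exact/sat_diag.
Qed.

(** The diagram of [snoc v c] is realized in [S], hence somewhere in [N]. Homogeneity of [N] then
    extends every realization of [diag v] in [N]; this is a sentence, so it passes to [S']. *)
Lemma forth n (v : 'I_n -> S) (w : 'I_n -> S') c : same_diag v w ->
  exists c', same_diag (snoc v c) (snoc w c').
Proof.
move=> vw; pose d := diag (snoc v c).
have [u ud] : exists u : 'I_n.+1 -> N, sat u d.
  apply: contrapT => /forallNP nd.
  have /(models_theory (FNeg d) SN) : forall u : 'I_n.+1 -> N, sat u (FNeg d) by exact: nd.
  by move=> /(_ (snoc v c)); apply; exact/sat_diag.
have : forall x : 'I_n -> N, sat x (FImp (diag v) (FNeg (FAll (rename (unlift ord_max) (FNeg d))))).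
  move=> x /sat_diag vx all.
  have nd a : sat (snoc x a) (FNeg d) by move: a; rewrite -sat_FAll_last.
  have [|c' /sat_diag] := @homN _ (u \o lift ord_max) x (u ord_max).
    apply: same_diag_trans vx; apply: same_diag_sym.
    rewrite -[v](snocK v c); apply: same_diag_comp; exact/sat_diag.
  rewrite snoc_lift => h; apply: (nd c').
  move/sat_diag in ud; apply/sat_diag; apply: same_diag_trans ud _; exact/sat_diag.
move=> /(models_theory _ S'N)/(_ w) h; apply: contrapT => /forallNP nc'.
apply: h; first exact/sat_diag.
suff : forall a, sat (snoc w a) (FNeg d) by rewrite -sat_FAll_last.
by move=> a /sat_diag; exact: nc'.
Qed.

End models_of_theory.

End sentences.

(** * Back and forth *)

Section back_and_forth.
Context {L : language} (S S' : structure L).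
Context (e : nat -> S) (e' : nat -> S').
Hypothesis eS : forall x, exists k, e k = x.
Hypothesis eS' : forall y, exists k, e' k = y.
Hypothesis start : forall (v : 'I_0 -> S) (w : 'I_0 -> S'), same_diag v w.
Hypothesis forthS : forall n (v : 'I_n -> S) (w : 'I_n -> S') c, same_diag v w ->
  exists c', same_diag (snoc v c) (snoc w c').
Hypothesis backS : forall n (v : 'I_n -> S) (w : 'I_n -> S') c', same_diag v w ->
  exists c, same_diag (snoc v c) (snoc w c').

(** A partial isomorphism with [k] pairs, carried by total sequences of which only the entries below
    [k] matter. *)
Let state k := {vw : (nat -> S) * (nat -> S') |
  same_diag (fun i : 'I_k => vw.1 i) (fun i : 'I_k => vw.2 i)}.

Let update (T : Type) (v : nat -> T) k c i := if i == k then c else v i.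

Let update_snoc (T : Type) (v : nat -> T) k c :
  (fun i : 'I_k.+1 => update v k c i) = snoc (fun i : 'I_k => v i) c.
Proof.
apply/funext => i; rewrite /update /snoc.
case: unliftP => [j ->|->]; last by rewrite eqxx.
by rewrite /= /bump leqNgt ltn_ord add0n ltn_eqF.
Qed.

(** Even stages go forth and exhaust [S] along [e]; odd stages go back and exhaust [S'] along
    [e']. *)
Let step k (s : state k) : exists s' : state k.+1,
  (forall i, (i < k)%N -> (sval s').1 i = (sval s).1 i /\ (sval s').2 i = (sval s).2 i) /\
  if odd k then (sval s').2 k = e' k./2 else (sval s').1 k = e k./2.
Proof.
case: s => -[v w] /= vw.
have [c [c' [cc' ck]]] : exists c c',
    same_diag (snoc (fun i : 'I_k => v i) c) (snoc (fun i : 'I_k => w i) c') /\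
    if odd k then c' = e' k./2 else c = e k./2.
  case: odd; first by have [c h] := backS (e' k./2) vw; exists c, (e' k./2).
  by have [c' h] := forthS (e k./2) vw; exists (e k./2), c'.
have good : same_diag (fun i : 'I_k.+1 => update v k c i) (fun i : 'I_k.+1 => update w k c' i).
  by rewrite !update_snoc.
exists (exist _ (update v k c, update w k c') good); split => /=.
  by move=> i ik; rewrite /update ltn_eqF.
by rewrite /update eqxx.
Qed.

Let state0 : state 0 := exist _ (fun=> e 0%N, fun=> e' 0%N) (start _ _).

Let chain := fix chain k : state k :=
  match k with 0 => state0 | k.+1 => sval (cid (step (chain k))) end.

Let v i := (sval (chain i.+1)).1 i.
Let w i := (sval (chain i.+1)).2 i.

Let chainE k i : (i < k)%N -> (sval (chain k)).1 i = v i /\ (sval (chain k)).2 i = w i.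
Proof.
elim: k => [//|k IH]; rewrite ltnS leq_eqVlt => /orP[/eqP->//|ik].
have [/(_ i ik)[-> ->] _] := svalP (cid (step (chain k))); exact: IH.
Qed.

Let vw k : same_diag (fun i : 'I_k => v i) (fun i : 'I_k => w i).
Proof.
have := svalP (chain k); congr same_diag; apply/funext => i.
  by have [] := chainE (ltn_ord i).
by have [] := chainE (ltn_ord i).
Qed.

Let chain_step k : if odd k then w k = e' k./2 else v k = e k./2.
Proof. by have [_] := svalP (cid (step (chain k))). Qed.

Let v_surj x : exists i, v i = x.
Proof.
have [k <-] := eS x; exists k.*2.
by have := chain_step k.*2; rewrite odd_double doubleK.
Qed.

Let w_surj y : exists i, w i = y.
Proof.
have [k <-] := eS' y; exists k.*2.+1.
by have := chain_step k.*2.+1; rewrite /= odd_double uphalf_double.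
Qed.

Lemma back_and_forth : isomorphic S S'.
Proof.
have vw_eq i j : v i = v j <-> w i = w j.
  have li : (i < maxn i j + 1)%N by rewrite addn1 ltnS leq_maxl.
  have lj : (j < maxn i j + 1)%N by rewrite addn1 ltnS leq_maxr.
  by have [h _] := vw (maxn i j + 1); exact: (h (Ordinal li) (Ordinal lj)).
pose iv x := sval (cid (v_surj x)); pose iw y := sval (cid (w_surj y)).
have ivK x : v (iv x) = x by exact: svalP (cid (v_surj x)).
have iwK y : w (iw y) = y by exact: svalP (cid (w_surj y)).
exists (w \o iv); split.
  exists (v \o iw) => x /=.
    by rewrite -[RHS]ivK; apply/vw_eq; rewrite iwK.
  by rewrite -[RHS]iwK; apply/vw_eq; rewrite ivK.
(* Stage [k] already contains all entries of [t], so the relation can be compared there. *)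
move=> r t; pose k := (\max_i iv (tnth t i)).+1.
pose u := map_tuple (fun x => inord (iv x) : 'I_k) t.

have uP i : val (tnth u i) = iv (tnth t i).
  by rewrite tnth_map /= inordK// ltnS (leq_bigmax (F := fun i => iv (tnth t i))).
have [_ /(_ r u)] := vw k.
have -> : map_tuple (fun i : 'I_k => v i) u = t.
  by apply: eq_from_tnth => i; rewrite tnth_map [nat_of_ord _]uP ivK.
have -> : map_tuple (fun i : 'I_k => w i) u = map_tuple (w \o iv) t => //.
by apply: eq_from_tnth => i; rewrite !tnth_map /= inordK// ltnS (leq_bigmax (F := fun i => iv (tnth t i))).
Qed.

End back_and_forth.

Section categoricity.
Context {L : language}.

Lemma countably_infinite_surj (S : structure L) : countably_infinite S ->
  exists e : nat -> S, forall x, exists k, e k = x.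
Proof.
rewrite /countably_infinite card_eq_sym => /card_bijP[f [g _ gK]].
exists (fun k => val (f (exist _ k (mem_set Logic.I)))) => x.
pose x' : [set: S] := exist _ x (mem_set Logic.I).
exists (val (g x')); rewrite (_ : exist _ _ _ = g x'); last exact: val_inj.
by rewrite gK.
Qed.

Lemma homogeneous_countably_categorical (N : structure L) :
  countably_infinite N -> homogeneous N -> countably_categorical (theory N).
Proof.
move=> cN homN; split; first by exists N; split=> // f.
move=> S S' SN S'N /countably_infinite_surj[e eS] /countably_infinite_surj[e' eS'].
apply: (back_and_forth eS eS').
- exact: same_diag_empty SN S'N.
- by move=> n v w c; exact: (forth homN SN S'N).
- move=> n v w c /same_diag_sym/(forth homN S'N SN c)[c' /same_diag_sym].
  by exists c'.
Qed.

End categoricity.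

(** * Generic paths *)

Section almost_everywhere.
Context {d : measure_display} {T : measurableType d} {R : realType} (P : probability T R).

Lemma ae_forall_countable (I : countType) (Q : I -> T -> Prop) :
  (forall i, {ae P, forall x, Q i x}) -> {ae P, forall x, forall i, Q i x}.
Proof.
move=> aeQ; have : {ae P, forall x, forall k, if unpickle k is Some i then Q i x else True}.
  apply/ae_foralln => k; case: (unpickle k : option I) => [i|]; first exact: aeQ.
  by apply: filterE.
by apply: filterS => x Qx i; have := Qx (pickle i); rewrite pickleK.
Qed.

Lemma ae_and (Q Q' : T -> Prop) :
  {ae P, forall x, Q x} -> {ae P, forall x, Q' x} -> {ae P, forall x, Q x /\ Q' x}.
Proof. by apply: filterS2 => x; split. Qed.

Lemma ae_not (X : set T) : measurable X -> P X = 0%E -> {ae P, forall x, ~ X x}.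
Proof. by move=> mX PX0; exists X; split=> // x /= /contrapT. Qed.

Lemma ae_ex (Q : T -> Prop) : {ae P, forall x, Q x} -> exists x, Q x.
Proof.
move=> [X [mX PX0 sub]]; apply: contrapT => /forallNP nQ.
have XT : X = setT by apply/seteqP; split=> // x _; apply: sub; exact: nQ.
by move: PX0; rewrite XT probability_setT => /eqP; rewrite onee_eq0.
Qed.

End almost_everywhere.

Section generic_type.
Context {R : realType} {L : language} {U : structure L} (M : set U).
Context (mu : formula L ('I_1 + U) -> R) (P : probability (borel_stone U nat setT) R).
Hypothesis M0 : M !=set0.
Hypothesis satM : forall n (p : stone U 'I_n M), exists b, realizes b p.
Hypothesis kmu : is_keisler mu.
Hypothesis ext : excellent_extension M mu.
Hypothesis path : is_path_measure M mu P.

Let exc : excellent M mu. Proof. by case: ext. Qed.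

Let inv : invariant_over M mu.
Proof. by have [[bd _] _] := exc; have [] := bd 0%N. Qed.

Let measurable_path_cylinder I (s : I -> nat) (f : formula L (I + U)) :
  measurable (cylinder setT (rename_vars s f) : set (borel_stone U nat setT)).
Proof. by apply: measurable_cylinder => u _. Qed.

Lemma ae_power_eq0 n (s : 'I_n.+1 -> nat) (f : formula L 'I_n.+1) :
  injective s -> power M mu n (no_params f) = 0 ->
  {ae P, forall p : borel_stone U nat setT, ~ formulas p (rename_vars s (no_params f))}.
Proof.
move=> sI f0; have P0 : P (cylinder setT (rename_vars s (no_params f))) = 0%E.
  rewrite (path_measure_injection M0 satM kmu exc path)// ?f0//.
  exact: params_no_params.
exact: (ae_not (measurable_path_cylinder s (no_params f)) P0).
Qed.

(** The fiber over the type of a point is the mass that [mu] gives to that point. *)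
Lemma power_FEq : no_point_mass mu -> power M mu 1 (no_params (FEq ord0 ord_max)) = 0.
Proof.
move=> npm; apply: EFin_inj; rewrite -(integral_fiberE M0 satM kmu exc path); last first.
  exact: params_no_params.
apply: integral0_eq => q _; congr (_%:E); have [b bq] := satM q.
rewrite (fiberE M0 inv _ bq); last by apply: params_rename_vars; exact: params_no_params.
rewrite -(npm (b ord0)); apply: (keisler_equiv kmu) => a.
rewrite sat_plug sat_rename_vars sat_no_params /=.
rewrite (_ : ord0 = lift ord_max ord0 :> 'I_2); last exact: val_inj.
by rewrite /last_first unlift_none liftK /=; split.
Qed.

Lemma nat_injection_extending n (s : 'I_n.+1 -> nat) : injective s ->
  exists2 t : nat -> nat, injective t & t \o val = s.
Proof.
move=> sI; pose B := (\max_i s i).+1.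
have sB i : (s i < B)%N by rewrite ltnS leq_bigmax.
(* Beyond [n] the values start above the bound [B] of [s], so they avoid its range. *)
exists (fun k => if (k < n.+1)%N then s (inord k) else (B + k)%N).
  move=> i j; case: ltnP => [i1|i1]; case: ltnP => [j1|j1].
  - by move/sI/(congr1 (@nat_of_ord _)); rewrite !inordK.
  - by have := sB (inord i); lia.
  - by have := sB (inord j); lia.
  - by lia.
by apply/funext => i /=; rewrite ltn_ord inord_val.
Qed.

Lemma ae_extension n (s : 'I_n.+1 -> nat) (a : 'I_n.+2 -> U) :
  injective s -> 0 < power M mu n.+1 (no_params (diag a)) ->
  {ae P, forall p : borel_stone U nat setT,
    formulas p (rename_vars s (no_params (diag (a \o lift ord_max)))) ->
    exists k, formulas p (rename_vars (snoc s k) (no_params (diag a)))}.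
Proof.
move=> sI a0; have [t tI ts] := nat_injection_extending sI.
have [_ /(_ n a a0)] := ext; rewrite no_params_rename => null.
have := ae_not_always_missed M0 satM kmu exc path (@params_no_params _ _ _ M _)
  (@params_no_params _ _ _ M _) tI null.
rewrite ts; apply: filterS => p + pa => /(_ pa)[k].
rewrite -[rename_vars _ _]/(FNeg (rename_vars _ _)).
(* The coordinate of candidate number [k]; failing the negated diagram, it satisfies the diagram. *)
move=> npk; exists (t (k + n).+1).
have -> : snoc s (t (k + n).+1) = (t \o val) \o widen_last k.
  apply/funext => i; rewrite /snoc /= /widen_last -ts; case: unliftP => [j _|_] //=.
  by rewrite /bump leqNgt ltn_ord val_widen.
by apply: contrapT => /(stoneN p) npk'; apply: npk; apply: npk' => u _.
Qed.

End generic_type.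

Section masks.
Context {L : language}.

(** Tuples of [U] may be uncountable in number, but their diagrams are sign patterns on [atoms n].
    Indexing by boolean lists leaves countably many almost sure conditions. *)
Definition diag_of_mask n (m : seq bool) : formula L 'I_n :=
  foldr FAnd FTop [seq if x.1 then x.2 else FNeg x.2 | x <- zip m (atoms n)].

Lemma diag_mask (S : structure L) n (v : 'I_n -> S) : exists m, diag v = diag_of_mask n m.
Proof.
exists [seq `[< sat v f >] | f <- atoms n]; rewrite /diag_of_mask /diag; congr foldr.
by rewrite -[X in zip _ X]map_id zip_map -map_comp.
Qed.

End masks.

(** Positivity ranges over tuples of arbitrary structures because it is applied to tuples of [N];
    extension concerns tuples of [U], as the axiom does. *)
Record generic {R : realType} {L : language} {U : structure L} (M : set U)
    (mu : formula L ('I_1 + U) -> R) (p : stone U nat setT) : Prop := {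
  generic_neq : forall i j, i != j -> ~ p (FEq (inl i) (inl j));
  generic_pos : forall n (S : structure L) (v : 'I_n.+1 -> S) (s : 'I_n.+1 -> nat),
    injective s -> p (rename_vars s (no_params (diag v))) ->
    power M mu n (no_params (diag v)) <> 0;
  generic_ext : forall n (a : 'I_n.+2 -> U) (s : 'I_n.+1 -> nat),
    injective s -> 0 < power M mu n.+1 (no_params (diag a)) ->
    p (rename_vars s (no_params (diag (a \o lift ord_max)))) ->
    exists k, p (rename_vars (snoc s k) (no_params (diag a))) }.

Lemma ae_generic {R : realType} {L : language} {U : structure L} (M : set U)
    (mu : formula L ('I_1 + U) -> R) (P : probability (borel_stone U nat setT) R) :
  M !=set0 -> (forall n (p : stone U 'I_n M), exists b, realizes b p) ->
  is_keisler mu -> excellent_extension M mu -> no_point_mass mu -> is_path_measure M mu P ->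
  {ae P, forall p : borel_stone U nat setT, generic M mu p}.
Proof.
move=> M0 satM kmu ext npm path.
have ae1 : {ae P, forall p : borel_stone U nat setT, forall i j, i != j ->
    ~ formulas p (FEq (inl i) (inl j))}.
  apply: ae_forall_countable => i; apply: ae_forall_countable => j.
  have [ij|ij] := eqVneq i j; first exact: filterE.
  have sI : injective (fun k : 'I_2 => if k == ord0 then i else j).
    move=> x y; have [->|->] := ordinal_2_cases x; have [->|->] := ordinal_2_cases y => //=.
      by move/eqP; rewrite (negPf ij).
    by move/esym/eqP; rewrite (negPf ij).
  by have := ae_power_eq0 M0 satM kmu ext path sI (power_FEq M0 satM kmu ext path npm);
    apply: filterS => p.
have ae2 : {ae P, forall p : borel_stone U nat setT, forall n (s : n.+1.-tuple nat) (m : seq bool),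
    injective (tnth s) -> formulas p (rename_vars (tnth s) (no_params (diag_of_mask n.+1 m))) ->
    power M mu n (no_params (diag_of_mask n.+1 m)) <> 0}.
  apply: ae_forall_countable => n; apply: ae_forall_countable => s.
  apply: ae_forall_countable => m.
  have [sI|nsI] := pselect (injective (tnth s)); last exact: filterE.
  have [m0|m0] := pselect (power M mu n (no_params (diag_of_mask n.+1 m)) = 0).
    by have := ae_power_eq0 M0 satM kmu ext path sI m0; apply: filterS => p np _ /np.
  exact: filterE.
have ae3 : {ae P, forall p : borel_stone U nat setT, forall n (s : n.+1.-tuple nat) (m : seq bool),
    injective (tnth s) -> forall a : 'I_n.+2 -> U, diag a = diag_of_mask n.+2 m ->
    0 < power M mu n.+1 (no_params (diag a)) ->
    formulas p (rename_vars (tnth s) (no_params (diag (a \o lift ord_max)))) ->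
    exists k, formulas p (rename_vars (snoc (tnth s) k) (no_params (diag a)))}.
  apply: ae_forall_countable => n; apply: ae_forall_countable => s.
  apply: ae_forall_countable => m.
  have [sI|nsI] := pselect (injective (tnth s)); last exact: filterE.
  (* All tuples with mask [m] share their diagram, so a single representative [b] of positive
     measure yields one null set for all of them. *)
  have [[b [bm b0]]|nb] := pselect (exists b : 'I_n.+2 -> U,
      diag b = diag_of_mask n.+2 m /\ 0 < power M mu n.+1 (no_params (diag b))); last first.
    by apply: filterE => p _ a am a0; case: nb; exists a.
  have := ae_extension M0 satM kmu ext path sI b0; apply: filterS => p pb _ a am _.
  have ab : same_diag a b by apply/sat_diag; rewrite am -bm; exact/sat_diag.
  by rewrite am -bm (diag_eq (same_diag_comp (lift ord_max) ab)).
have tnthE n (s : 'I_n -> nat) : tnth [tuple s i | i < n] = s.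
  by apply/funext => i; rewrite tnth_mktuple.
apply: filterS3 ae1 ae2 ae3 => p p1 p2 p3; split=> [//|n S v s|n a s].
  have [m ->] := diag_mask v; rewrite -(tnthE _ s); exact: p2.
have [m am] := diag_mask a; rewrite -(tnthE _ s) => sI; exact: p3 am.
Qed.

(** * The structure induced by a generic path *)

Section generic_structure.
Context {R : realType} {L : language} {U : structure L} (M : set U).
Context (mu : formula L ('I_1 + U) -> R) (P : probability (borel_stone U nat setT) R).
Context (N : structure L) (p : stone U nat setT).
Hypothesis path : is_path_measure M mu P.
Hypothesis pN : iso_class N p.
Hypothesis gen : generic M mu p.

(** Coordinates of a generic path are pairwise distinct, so the isomorphism of its range with [N]
    labels each point of [N] by exactly one index. *)
Lemma iso_class_enumeration : exists2 g : N -> nat, bijective g &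
  forall n (v : 'I_n -> N) (S : structure L) (w : 'I_n -> S),
    same_diag v w <-> formulas p (rename_vars (g \o v) (no_params (diag w))).
Proof.
have [W [j [a [_ pa [ha [h [[h' hK h'K] hrel]]]]]]] := pN.
have satP I (s : I -> nat) (f : formula L I) :
    formulas p (rename_vars s (no_params f)) <-> sat (a \o s) f.
  rewrite -(sat_no_params (a \o s) j) -sat_rename_vars; split; first exact: pa.
  move=> af; apply: contrapT => /(stoneN p) npf.
  by have /pa := npf (fun u _ => Logic.I); apply.
have aI i k : a i = a k -> i = k.
  have [//|ik aik] := eqVneq i k; exfalso; apply: (generic_neq gen ik).
  apply: contrapT => /(stoneN p) npf.
  by have /pa := npf (fun u _ => Logic.I); apply.
have gP x : exists k, a k = val (h' x) by have := valP (h' x); rewrite inE => -[k _ <-]; exists k.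
pose g x := sval (cid (gP x)).
have gE x : a (g x) = val (h' x) by exact: svalP (cid (gP x)).
have aR k : a k \in range a by rewrite inE; exists k.
exists g.
  exists (fun k => h (exist _ (a k) (aR k))) => [x|k].
    by rewrite -[RHS]h'K; congr h; apply: val_inj; rewrite /= gE.
  by apply: aI; rewrite gE hK.
have vg n (v : 'I_n -> N) : same_diag v (a \o g \o v).
  split=> [i k|r t].
    split=> [/= ->//|/=]; rewrite !gE => /val_inj e.
    by rewrite -[LHS]h'K e h'K.
  have := hrel r (map_tuple (h' \o v) t); rewrite map_tuple_comp.
  rewrite (_ : map_tuple (h \o _) t = map_tuple v t); last first.
    by apply: eq_from_tnth => i; rewrite !tnth_map /= h'K.
  move=> <-; rewrite /= map_tuple_comp (_ : map_tuple (_ \o _) t = map_tuple (a \o g \o v) t)//.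
  by apply: eq_from_tnth => i; rewrite !tnth_map /= gE.
move=> n v S w; rewrite satP; split=> [vw|/sat_diag wv].
  by apply/sat_diag; apply: same_diag_trans (same_diag_sym vw) (vg _ _).
exact: same_diag_trans (vg _ _) (same_diag_sym wv).
Qed.

Lemma generic_countably_infinite : countably_infinite N.
Proof.
have [g [g' gK g'K] _] := iso_class_enumeration.
rewrite /countably_infinite; apply/card_bijP.
exists (fun x : [set: N] => exist _ (g (val x)) (mem_set Logic.I) : [set: nat]).
exists (fun k : [set: nat] => exist _ (g' (val k)) (mem_set Logic.I) : [set: N]) => x.
  by apply: val_inj; rewrite /= gK.
by apply: val_inj; rewrite /= g'K.
Qed.

(** A cylinder of positive measure contains a type, and types are finitely satisfiable in [U]. This
    moves a diagram from [N] to [U], where the extension axiom applies. *)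
Lemma positive_diag_realized n (S : structure L) (v : 'I_n.+1 -> S) :
  0 < power M mu n (no_params (diag v)) -> exists a : 'I_n.+1 -> U, same_diag v a.
Proof.
have [_ pathP] := path; rewrite -lte_fin -pathP => pos.
have [q qv] : exists q : stone U nat setT,
    cylinder setT (rename_vars (@nat_of_ord n.+1) (no_params (diag v))) q.
  apply: contrapT => /forallNP nq; move: pos.
  by rewrite (_ : cylinder _ _ = set0) ?measure0 ?ltxx//; apply/seteqP; split.
have [_ fin _] := formulasP q.
have [|b bP] := fin [:: rename_vars (@nat_of_ord n.+1) (no_params (diag v))].
  by move=> f; rewrite inE => /eqP->.
exists (b \o @nat_of_ord n.+1); apply/sat_diag.
by rewrite -(sat_no_params _ id) -sat_rename_vars; apply: bP; rewrite mem_head.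
Qed.

(** The diagram of [snoc v c] occurs along the path, so it has positive measure and a copy [a] in
    [U]. The tuple [w] realizes the restriction of this diagram, and [generic_ext] supplies the
    missing coordinate. *)
Lemma generic_homogeneous : homogeneous N.
Proof.
have [g gbij gP] := iso_class_enumeration; have gI := bij_inj gbij.
apply: homogeneousP => n v w c vI vc vw.
have vcI : injective (snoc v c).
  move=> i k; rewrite /snoc; case: (unliftP ord_max i) => [i' ->|->];
    case: (unliftP ord_max k) => [k' ->|->] //; first by move=> /vI->.
    by move=> e; have := vc i'; rewrite e.
  by move=> /esym e; have := vc k'; rewrite e.
have pvc : formulas p (rename_vars (g \o snoc v c) (no_params (diag (snoc v c)))).
  by apply/gP; split.
have vc0 : 0 < power M mu n.+1 (no_params (diag (snoc v c))).
  rewrite lt_def; apply/andP; split.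
    by apply/eqP; apply: (generic_pos gen) pvc; exact: inj_comp.
  have [_ pathP] := path; rewrite -lee_fin -pathP; exact: measure_ge0.
have [a va] := positive_diag_realized vc0.
have a0 : 0 < power M mu n.+1 (no_params (diag a)) by rewrite -(diag_eq va).
have wI : injective w by move=> i k wik; apply: vI; apply/(proj1 vw).
have wa : same_diag w (a \o lift ord_max).
  apply: same_diag_trans (same_diag_sym vw) _.
  by rewrite -[v](snocK v c); exact: same_diag_comp.
have [k pk] := generic_ext gen (inj_comp gI wI) a0 (proj1 (gP _ _ _ _) wa).
have [g' gK g'K] := gbij; exists (g' k).
apply: same_diag_trans va (same_diag_sym _); apply/gP.
by rewrite comp_snoc g'K.
Qed.

End generic_structure.

Theorem theorem4p15 (R : realType) (L : language) (T : set (formula L void))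
    (K : Type) (U : structure L) (M : set U)
    (mu : formula L ('I_1 + U) -> R)
    (P : probability (borel_stone U nat setT) R) (N : structure L) :
  complete_theory T -> models U T -> monster K U ->
  small_set K M -> elementary_substructure M ->
  is_keisler mu -> invariant_over M mu ->
  excellent_extension M mu -> no_point_mass mu ->
  is_path_measure M mu P ->
  {ae P, forall p, iso_class N p} ->
  countably_categorical (theory N).
Proof.
move=> _ _ mon smallM [M0 _] kmu _ ext npm path aeN.
have satM n (q : stone U 'I_n M) : exists b, realizes b q by exact: (monster_saturated mon).
have aeG := ae_generic M0 satM kmu ext npm path.
(* Two almost sure events meet, and a single path in both determines [N] up to isomorphism. *)
have [p [pN pG]] := ae_ex (ae_and aeN aeG).
apply: homogeneous_countably_categorical; first exact: generic_countably_infinite pN pG.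
exact: generic_homogeneous path pN pG.
Qed.
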